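(* Let $M$ be a finitely generated torsion-free, integrally closed $R$-module without a free direct summand, and let $e=\operatorname{rank}_R(M)\ge 2$. Assume that (1) $\operatorname{ord}(I(M))\ge e+1$, (2) $\overline{I_1(M)}=\mathfrak m^{e-1}$, and (3) $M$ is not indecomposable. Then there exist an integer $1\le \ell\le e$ and an indecomposable integrally closed $R$-module $L$ such that $$M\cong \mathfrak m^{\oplus \ell}\oplus L.$$ In particular, $M$ has the maximal ideal $\mathfrak m$ as a direct summand.
   Context: $(R,\mathfrak m)$ is a two-dimensional regular local ring with infinite residue field. For an ideal $\mathfrak a$ of $R$, $\operatorname{ord}(\mathfrak a)=\max\{n\mid \mathfrak a\subset\mathfrak m^n\}$ and $\overline{\mathfrak a}$ is its integral closure. For a finitely generated torsion-free $R$-module $M$, the double dual $F=M^{**}$ is free and canonically contains $M$ with $F/M$ of finite length. Define $I(M)=\operatorname{Fitt}_0(F/M)$ and $I_1(M)=\operatorname{Fitt}_1(F/M)$ (Fitting ideals). Integral closure of modules (Rees): with $K$ the fraction field of $R$, $M_K=M\otimes_R K$, and $MV$ the image of $M\otimes_R V\to M_K$ for $R\subset V\subset K$, set $\overline M=\{f\in M_K\mid f\in MV$ for every discrete valuation ring $V$ with $R\subset V\subset K\}$; $M$ is integrally closed if $\overline M=M$. *)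

(* Defs.v *)
From HB Require Import structures.
From mathcomp Require Import all_boot all_algebra.
From mathcomp Require Import ring.
From mathcomp Require Import boolp classical_sets functions cardinality.

Set Implicit Arguments.
Unset Strict Implicit.
Unset Printing Implicit Defensive.

Import GRing.Theory.
Local Open Scope classical_set_scope.
Local Open Scope quotient_scope.
Local Open Scope ring_scope.

(* Submodules are the bundled predicates [submodClosed M]; ideals of R are the
   submodules of the regular module R^o. *)

Section Span.
Variables (R : comNzRingType) (M : lmodType R).

Definition span (X : set M) : {pred M} :=
  [pred x | `[< exists s : seq (R * M),
     (forall p, p \in s -> X p.2) /\ x = \sum_(p <- s) p.1 *: p.2 >]].

Lemma span_closed (X : set M) : submod_closed (span X).
Proof.
split=> [|a u v].
  by apply/asboolP; exists [::]; rewrite big_nil.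
move=> /asboolP[s [Xs ->]] /asboolP[t [Xt ->]]; apply/asboolP.
exists ([seq (a * p.1, p.2) | p <- s] ++ t); split=> [p|].
  by rewrite mem_cat => /orP[/mapP[q qs ->]|/Xt//]; exact: (Xs _ qs).
rewrite big_cat big_map scaler_sumr; congr (_ + _).
by apply: eq_bigr => p _; rewrite scalerA.
Qed.

HB.instance Definition _ (X : set M) :=
  GRing.isSubmodClosed.Build R M (span X) (span_closed X).

Definition generates n (g : 'I_n -> M) : Prop :=
  forall x, exists a : 'I_n -> R, x = \sum_i a i *: g i.

Definition finitely_generated : Prop := exists n (g : 'I_n -> M), generates g.

Definition torsion_free : Prop :=
  forall (r : R) (x : M), r *: x = 0 -> r = 0 \/ x = 0.

End Span.

Section SubmoduleType.
Variables (R : comNzRingType) (M : lmodType R) (N : submodClosed M).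

Definition submod_type : Type := {x : M | x \in N}.

HB.instance Definition _ := [isSub of submod_type for @sval M (fun x => x \in N)].
HB.instance Definition _ := [Choice of submod_type by <:].
HB.instance Definition _ := [SubChoice_isSubLmodule of submod_type by <:].

End SubmoduleType.

Section QuotientModule.
Variables (R : comNzRingType) (M : lmodType R) (N : submodClosed M).

Definition submod_zmod : {pred M} := N.

Lemma submod_zmod_closed : zmod_closed submod_zmod.
Proof.
have [N0 NZ] := submodClosedP N; split=> // x y Nx Ny.
by rewrite addrC -scaleN1r; exact: NZ.
Qed.

HB.instance Definition _ :=
  GRing.isZmodClosed.Build M submod_zmod submod_zmod_closed.

Definition quot_mod : Type := Quotient.quot submod_zmod.
HB.instance Definition _ := GRing.Zmodule.on quot_mod.

Local Notation pi := (\pi_(Quotient.quot submod_zmod)).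

Definition quot_scale (a : R) (x : quot_mod) : quot_mod := pi (a *: repr x).

Lemma pi_scale a x : quot_scale a (pi x) = pi (a *: x) :> quot_mod.
Proof.
apply/eqP; rewrite -Quotient.idealrBE -scalerBr.
have Nx : repr (pi x) - x \in submod_zmod by rewrite Quotient.idealrBE reprK.
have [N0 NZ] := submodClosedP N.
by rewrite -[_ *: _]addr0; exact: NZ.
Qed.

Lemma pi_addM x y : pi x + pi y = pi (x + y) :> quot_mod.
Proof. by rewrite raddfD. Qed.

Lemma quot_modW (P : quot_mod -> Prop) : (forall x, P (pi x)) -> forall q, P q.
Proof. by move=> Ppi q; rewrite -[q](@reprK _ (Quotient.quot submod_zmod)). Qed.

Lemma quot_scaleA a b x : quot_scale a (quot_scale b x) = quot_scale (a * b) x.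
Proof. by elim/quot_modW: x => x; rewrite !pi_scale scalerA. Qed.

Lemma quot_scale1 : left_id 1 quot_scale.
Proof. by elim/quot_modW=> x; rewrite pi_scale scale1r. Qed.

Lemma quot_scaleDr : right_distributive quot_scale +%R.
Proof.
move=> a; elim/quot_modW=> x; elim/quot_modW=> y.
by rewrite pi_addM !pi_scale pi_addM scalerDr.
Qed.

Lemma quot_scaleDl x : {morph quot_scale^~ x : a b / a + b}.
Proof. by move=> a b; elim/quot_modW: x => x; rewrite !pi_scale pi_addM scalerDl. Qed.

HB.instance Definition _ := GRing.Zmodule_isLmodule.Build R quot_mod
  quot_scaleA quot_scale1 quot_scaleDr quot_scaleDl.

End QuotientModule.

Section DualModule.
Variables (R : comNzRingType) (M : lmodType R).

Definition dual : Type := {linear M -> R^o}.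

HB.instance Definition _ := gen_eqMixin dual.
HB.instance Definition _ := gen_choiceMixin dual.

Definition dual_fun (f : dual) : M -> R^o := (f : {linear M -> R^o}).

Lemma dual_ext (f g : dual) : dual_fun f =1 dual_fun g -> f = g.
Proof.
case: f g => [f cf] [g cg] /funext /= fg; move: cf cg.
rewrite /dual_fun /= in fg; rewrite fg => -[[?] [?]] [[?] [?]].
by congr (GRing.Linear.Pack (GRing.Linear.Class (Algebra.isNmodMorphism.Axioms_ _ _ _)
  (GRing.isScalable.Axioms_ _ _ _ _ _))); exact: Prop_irrelevance.
Qed.

Definition dual0 : dual := (\0 : M -> R^o).
Definition dual_add (f g : dual) : dual :=
  ((f : {linear M -> R^o}) \+ (g : {linear M -> R^o})).
Definition dual_opp (f : dual) : dual := (\- (f : {linear M -> R^o})).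
Definition dual_scale (a : R) (f : dual) : dual := (a \*: (f : {linear M -> R^o})).

Lemma dual_addA : associative dual_add.
Proof. by move=> f g h; apply: dual_ext => x; exact: addrA. Qed.

Lemma dual_addC : commutative dual_add.
Proof. by move=> f g; apply: dual_ext => x; exact: addrC. Qed.

Lemma dual_add0 : left_id dual0 dual_add.
Proof. by move=> f; apply: dual_ext => x; exact: add0r. Qed.

Lemma dual_addN : left_inverse dual0 dual_opp dual_add.
Proof. by move=> f; apply: dual_ext => x; exact: addNr. Qed.

HB.instance Definition _ :=
  GRing.isZmodule.Build dual dual_addA dual_addC dual_add0 dual_addN.

Lemma dual_scaleA a b f : dual_scale a (dual_scale b f) = dual_scale (a * b) f.
Proof. by apply: dual_ext => x; exact: scalerA. Qed.

Lemma dual_scale1 : left_id 1 dual_scale.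
Proof. by move=> f; apply: dual_ext => x; exact: scale1r. Qed.

Lemma dual_scaleDr : right_distributive dual_scale +%R.
Proof. by move=> a f g; apply: dual_ext => x; exact: scalerDr. Qed.

Lemma dual_scaleDl f : {morph dual_scale^~ f : a b / a + b}.
Proof. by move=> a b; apply: dual_ext => x; exact: scalerDl. Qed.

HB.instance Definition _ := GRing.Zmodule_isLmodule.Build R dual
  dual_scaleA dual_scale1 dual_scaleDr dual_scaleDl.

End DualModule.

Section Bidual.
Variables (R : comNzRingType) (M : lmodType R).

Definition eval_at (x : M) (f : dual M) : R^o := dual_fun f x.

Lemma eval_at_is_linear x : linear (eval_at x).
Proof. by []. Qed.

HB.instance Definition _ (x : M) :=
  GRing.isLinear.Build R (dual M) R^o *:%R (eval_at x) (eval_at_is_linear x).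

Definition to_bidual (x : M) : dual (dual M) := eval_at x : {linear dual M -> R^o}.

Definition bidual_image : {pred dual (dual M)} :=
  [pred phi | `[< exists x, phi = to_bidual x >]].

Lemma bidual_image_closed : submod_closed bidual_image.
Proof.
split=> [|a u v].
  apply/asboolP; exists 0; apply: dual_ext => f.
  by rewrite /= /dual_fun /= /eval_at /dual_fun linear0.
move=> /asboolP[x ->] /asboolP[y ->]; apply/asboolP; exists (a *: x + y).
by apply: dual_ext => f; rewrite /= /dual_fun /= /eval_at /dual_fun linearP.
Qed.

HB.instance Definition _ :=
  GRing.isSubmodClosed.Build R (dual (dual M)) bidual_image bidual_image_closed.

(* F / M with F = M^{**} *)
Definition bidual_quot : Type := quot_mod bidual_image.
HB.instance Definition _ := GRing.Lmodule.on bidual_quot.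

End Bidual.

Section Fitting.
Variables (R : comNzRingType) (Q : lmodType R) (j : nat).

(* The (n - j)-minors of the matrix of relations between n generators g of Q:
   the rows of A are arbitrary relations between the g k, and f selects the
   columns. As n - j is truncated, these minors are 1 when n <= j. *)
Definition relation_minors n (g : 'I_n -> Q) : set R^o :=
  [set d | exists (A : 'M[R]_(n - j, n)) (f : 'I_(n - j) -> 'I_n),
     (forall i, \sum_k A i k *: g k = 0) /\ d = \det (colsub f A)].

(* Fitt_j(Q) for a finitely generated Q; the ideal spanned by the minors does
   not depend on the choice of the generators g. *)
Definition fitting : {pred R} :=
  [pred x | `[< exists n (g : 'I_n -> Q),
                generates g /\ (x : R^o) \in span (relation_minors g) >]].

End Fitting.

Section FittingBidual.
Variables (R : comNzRingType) (M : lmodType R).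

(* I(M) and I_1(M) *)
Definition fitt0_bidual : {pred R} := fitting (bidual_quot M) 0.
Definition fitt1_bidual : {pred R} := fitting (bidual_quot M) 1.

End FittingBidual.

Section Ideals.
Variable R : comNzRingType.
Implicit Types (I J P m : submodClosed R^o).

Definition ideal_exp (I : {pred R}) (n : nat) : {pred R} :=
  span [set x : R^o | exists f : 'I_n -> R, (forall i, f i \in I) /\ x = \prod_i f i].

(* [integral_closure I] collects the roots of the polynomials
   X^{n+1} + c_0 X^n + ... + c_n with c_i in I^{i+1}. *)
Definition integral_closure (I : {pred R}) : {pred R} :=
  [pred x | `[< exists n (c : 'I_n.+1 -> R),
     (forall i, c i \in ideal_exp I i.+1) /\
     x ^+ n.+1 + \sum_(i < n.+1) c i * x ^+ (n - i) = 0 >]].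

Definition is_prime I : Prop :=
  (1 : R) \notin I /\ forall x y : R, x * y \in I -> x \in I \/ y \in I.

Definition is_maximal I : Prop :=
  (1 : R) \notin I /\
  forall J, {subset I <= J} -> (1 : R) \notin J -> {subset J <= I}.

Definition is_local m : Prop := is_maximal m /\ forall J, is_maximal J -> J =i m.

Definition noetherian : Prop :=
  forall I, exists n (g : 'I_n -> R^o), I =i span (range g).

(* P_0 < P_1 < ... < P_n *)
Definition prime_chain (n : nat) : Prop :=
  exists P : nat -> submodClosed R^o,
    (forall i, (i <= n)%N -> is_prime (P i)) /\
    (forall i, (i < n)%N -> {subset P i <= P i.+1} /\ ~ {subset P i.+1 <= P i}).

Definition krull_dim (d : nat) : Prop :=
  prime_chain d /\ forall n, prime_chain n -> (n <= d)%N.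

(* (R, m) is a regular local ring of dimension d. *)
Definition regular_local m (d : nat) : Prop :=
  [/\ noetherian, is_local m, krull_dim d &
      exists g : 'I_d -> R^o, m =i span (range g)].

(* n = ord(I) = max {n | I is contained in m^n} *)
Definition is_ord m (I : {pred R}) (n : nat) : Prop :=
  {subset I <= ideal_exp (m : {pred R}) n} /\
  forall k, {subset I <= ideal_exp (m : {pred R}) k} -> (k <= n)%N.

End Ideals.

Section Decompositions.
Variable R : comNzRingType.

Definition module_iso (M N : lmodType R) : Prop :=
  exists f : {linear M -> N}, bijective f.

Definition direct_summand (N M : lmodType R) : Prop :=
  exists N' : lmodType R, module_iso M (N * N')%type.

Definition has_free_summand (M : lmodType R) : Prop :=
  exists n, (0 < n)%N /\ direct_summand 'rV[R]_n M.

Definition trivial_module (M : lmodType R) : Prop := forall x : M, x = 0.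

Definition indecomposable (M : lmodType R) : Prop :=
  ~ trivial_module M /\
  forall N N' : lmodType R, module_iso M (N * N')%type ->
    trivial_module N \/ trivial_module N'.

End Decompositions.

Section FractionModule.
Variables (R : idomainType) (M : lmodType R).
Local Notation K := {fraction R}.

(* M_K = M (x)_R K is built as the localization of M at the nonzero elements
   of R, the pair (x, s) standing for x / s. *)
Definition mfrac : Type := (M * {s : R | s != 0})%type.
HB.instance Definition _ := Choice.on mfrac.

Implicit Types u v w : mfrac.
Local Notation den u := (sval u.2).

Definition MFrac (x : M) (s : R) (s0 : s != 0) : mfrac := (x, exist _ s s0).

Lemma den_neq0 u : den u != 0. Proof. exact: (svalP u.2). Qed.

Definition mfrac_equiv u v : bool :=
  `[< exists t : R, t != 0 /\ (t * den v) *: u.1 = (t * den u) *: v.1 >].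

Lemma mfrac_equiv_is_equiv : equiv_class_of mfrac_equiv.
Proof.
split=> [u|u v|v u w].
- by apply/asboolP; exists 1; rewrite oner_neq0.
- by apply/asboolP/asboolP => -[t [t0 e]]; exists t.
move=> /asboolP[t [t0 e]] /asboolP[t' [t'0 e']]; apply/asboolP.
exists (t * t' * den v); rewrite !mulf_neq0 ?den_neq0//; split=> //.
move/(congr1 (fun x => (t' * den w) *: x)): e.
move/(congr1 (fun x => (t * den u) *: x)): e'.
rewrite !scalerA => e' e.
have -> : t * t' * den v * den w = t' * den w * (t * den v) by ring.
rewrite e.
have -> : t' * den w * (t * den u) = t * den u * (t' * den w) by ring.
by rewrite e'; congr (_ *: _); ring.
Qed.

Canonical mfrac_equiv_rel := EquivRelPack mfrac_equiv_is_equiv.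
Canonical mfrac_encModRel := defaultEncModRel mfrac_equiv.

Definition frac_mod : Type := {eq_quot mfrac_equiv}.
HB.instance Definition _ : EqQuotient _ mfrac_equiv frac_mod :=
  EqQuotient.on frac_mod.
HB.instance Definition _ := Choice.on frac_mod.

Local Notation pi := (\pi_frac_mod).

Lemma frac_modW (P : frac_mod -> Prop) : (forall u, P (pi u)) -> forall x, P x.
Proof. by move=> Ppi x; rewrite -[x]reprK. Qed.

Lemma pi_fracP u v :
  pi u = pi v <-> exists t, t != 0 /\ (t * den v) *: u.1 = (t * den u) *: v.1.
Proof.
by split=> [/eqmodP/asboolP //|e]; apply/eqmodP/asboolP.
Qed.

Definition mfrac_add u v : mfrac :=
  MFrac (den v *: u.1 + den u *: v.1) (mulf_neq0 (den_neq0 u) (den_neq0 v)).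
Definition mfrac_opp u : mfrac := MFrac (- u.1) (den_neq0 u).
Definition mfrac_scale (k : {ratio R}) u : mfrac :=
  MFrac (\n_k *: u.1) (mulf_neq0 (denom_ratioP k) (den_neq0 u)).

Definition frac_add (x y : frac_mod) : frac_mod := pi (mfrac_add (repr x) (repr y)).
Definition frac_opp (x : frac_mod) : frac_mod := pi (mfrac_opp (repr x)).
Definition frac_scale (k : K) (x : frac_mod) : frac_mod :=
  pi (mfrac_scale (repr k) (repr x)).

Lemma pi_frac_add u v : frac_add (pi u) (pi v) = pi (mfrac_add u v).
Proof.
have /pi_fracP[t [t0 e]] : pi (repr (pi u)) = pi u by rewrite reprK.
have /pi_fracP[t' [t'0 e']] : pi (repr (pi v)) = pi v by rewrite reprK.
apply/pi_fracP; exists (t * t'); split; first by rewrite mulf_neq0.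
rewrite /= !scalerDr !scalerA; move: (repr (pi u)) (repr (pi v)) e e' => u' v' e e'.
congr (_ + _).
- move/(congr1 (fun x => (t' * den v * den v') *: x)): e; rewrite !scalerA => e.
  by apply: etrans (etrans _ e) _; congr (_ *: _); ring.
- move/(congr1 (fun x => (t * den u * den u') *: x)): e'; rewrite !scalerA => {}e.
  by apply: etrans (etrans _ e) _; congr (_ *: _); ring.
Qed.

Lemma pi_frac_opp u : frac_opp (pi u) = pi (mfrac_opp u).
Proof.
have /pi_fracP[t [t0 e]] : pi (repr (pi u)) = pi u by rewrite reprK.
by apply/pi_fracP; exists t; split=> //=; rewrite !scalerN e.
Qed.

Lemma pi_frac_scale (k : {ratio R}) u :
  frac_scale (\pi_K k) (pi u) = pi (mfrac_scale k u).
Proof.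
have /pi_fracP[t [t0 e]] : pi (repr (pi u)) = pi u by rewrite reprK.
have ek := FracField.equivf_l k.
apply/pi_fracP; exists t; split=> //=; rewrite !scalerA.
move: (repr (pi u)) (repr (\pi_K k)) e ek => u' k' e ek.
move/(congr1 (fun x => (\n_k' * \d_k) *: x)): e; rewrite !scalerA => e.
apply: etrans (etrans _ e) _; first by congr (_ *: _); ring.
by rewrite ek; congr (_ *: _); ring.
Qed.

Definition frac0 : frac_mod := pi (MFrac 0 (oner_neq0 R)).

Lemma frac_addA : associative frac_add.
Proof.
elim/frac_modW=> u; elim/frac_modW=> v; elim/frac_modW=> w.
rewrite !pi_frac_add; apply/pi_fracP; exists 1; rewrite oner_neq0; split=> //=.
rewrite !scalerDr !scalerA addrA.
by congr (_ + _ + _); congr (_ *: _); ring.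
Qed.

Lemma frac_addC : commutative frac_add.
Proof.
elim/frac_modW=> u; elim/frac_modW=> v.
rewrite !pi_frac_add; apply/pi_fracP; exists 1; rewrite oner_neq0; split=> //=.
rewrite !scalerDr !scalerA addrC.
by congr (_ + _); congr (_ *: _); ring.
Qed.

Lemma frac_add0 : left_id frac0 frac_add.
Proof.
elim/frac_modW=> u.
rewrite !pi_frac_add; apply/pi_fracP; exists 1; rewrite oner_neq0; split=> //=.
by rewrite scaler0 add0r scale1r !mul1r.
Qed.

Lemma frac_addN : left_inverse frac0 frac_opp frac_add.
Proof.
elim/frac_modW=> u.
rewrite pi_frac_opp pi_frac_add; apply/pi_fracP; exists 1.
by rewrite oner_neq0; split=> //=; rewrite scalerN addNr !scaler0.
Qed.

HB.instance Definition _ :=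
  GRing.isZmodule.Build frac_mod frac_addA frac_addC frac_add0 frac_addN.

Lemma fracW (P : K -> Prop) : (forall k, P (\pi_K k)) -> forall x, P x.
Proof. by move=> Ppi x; rewrite -[x]reprK. Qed.

Lemma frac_scaleA a b x : frac_scale a (frac_scale b x) = frac_scale (a * b) x.
Proof.
elim/fracW: a => a; elim/fracW: b => b; elim/frac_modW: x => u.
rewrite -[_ * _]FracField.pi_mul !pi_frac_scale.
apply/pi_fracP; exists 1; rewrite oner_neq0; split=> //=.
rewrite !numden_Ratio ?mulf_neq0 ?denom_ratioP// !scalerA.
by congr (_ *: _); ring.
Qed.

Lemma frac_scale1 : left_id 1 frac_scale.
Proof.
elim/frac_modW=> u; have -> : (1 : K) = \pi_K (Ratio 1 1).
  by rewrite -[1 in LHS]tofrac1; unlock FracField.tofrac.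
rewrite pi_frac_scale; apply/pi_fracP; exists 1; rewrite oner_neq0; split=> //=.
by rewrite !numden_Ratio ?oner_neq0// scale1r !mul1r.
Qed.

Lemma frac_scaleDr : right_distributive frac_scale +%R.
Proof.
move=> a; elim/frac_modW=> u; elim/frac_modW=> v; elim/fracW: a => a.
rewrite -[pi _ + pi _]/(frac_add _ _) pi_frac_add !pi_frac_scale.
rewrite -[RHS]/(frac_add _ _) pi_frac_add.
apply/pi_fracP; exists 1; rewrite oner_neq0; split=> //=.
by rewrite !scalerDr !scalerA; congr (_ + _); congr (_ *: _); ring.
Qed.

Lemma frac_scaleDl x : {morph frac_scale^~ x : a b / a + b}.
Proof.
elim/fracW=> a; elim/fracW=> b; elim/frac_modW: x => u.
rewrite -[\pi_K a + _]FracField.pi_add !pi_frac_scale.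
rewrite -[RHS]/(frac_add _ _) pi_frac_add.
apply/pi_fracP; exists 1; rewrite oner_neq0; split=> //=.
rewrite !numden_Ratio ?mulf_neq0 ?denom_ratioP// !scalerDr !scalerA -scalerDl.
by congr (_ *: _); ring.
Qed.

HB.instance Definition _ := GRing.Zmodule_isLmodule.Build K frac_mod
  frac_scaleA frac_scale1 frac_scaleDr frac_scaleDl.

Definition to_frac_mod (x : M) : frac_mod := pi (MFrac x (oner_neq0 R)).

End FractionModule.

Section IntegralClosure.
Variable R : idomainType.
Local Notation K := {fraction R}.

Definition has_rank (M : lmodType R) (e : nat) : Prop :=
  module_iso (frac_mod M) 'rV[K]_e.

(* The value v 0 is irrelevant. *)
Definition discrete_valuation (v : K -> int) : Prop :=
  [/\ forall n : int, exists2 x : K, x != 0 & v x = n,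
      forall x y : K, x != 0 -> y != 0 -> v (x * y) = v x + v y &
      forall x y : K, x != 0 -> y != 0 -> x + y != 0 ->
        v x <= v (x + y) \/ v y <= v (x + y)].

(* V is a discrete valuation ring with R <= V <= K; its fraction field is then
   K, so that V is the valuation ring of a discrete valuation of K. *)
Definition dvr_between (V : set K) : Prop :=
  (forall r : R, V (FracField.tofrac r)) /\
  exists2 v, discrete_valuation v & forall x, V x <-> x = 0 \/ 0 <= v x.

(* MV, the image of M (x)_R V in M_K *)
Definition module_extension (M : lmodType R) (V : set K) : set (frac_mod M) :=
  [set f | exists s : seq (K * M),
     (forall p, p \in s -> V p.1) /\ f = \sum_(p <- s) p.1 *: to_frac_mod p.2].

Arguments module_extension M V _ : clear implicits.

Definition module_closure (M : lmodType R) : set (frac_mod M) :=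
  [set f | forall V : set K, dvr_between V -> module_extension M V f].

Arguments module_closure M _ : clear implicits.

Definition integrally_closed (M : lmodType R) : Prop :=
  module_closure M = range (@to_frac_mod R M).

End IntegralClosure.

(* Main.v *)
From HB Require Import structures.
From mathcomp Require Import all_boot all_order all_algebra.
From mathcomp Require Import perm ring zify.
Require Import Defs.
From mathcomp Require Import boolp classical_sets functions cardinality.

(** The bidual F of M is free of rank e, because the dual of a finitely
    generated module over a two-dimensional regular local ring is free
    ([dual_free]): modulo a regular parameter x, the ring is a discrete valuation
    ring and the dual embeds in a free module. A basis b of the dual of M embeds
    M in R^e by the coordinates b_j(x), and these lie in m because M has no free
    summand. The ideals I(M) and I_1(M) are then the ideals [minors M e] and
    [minors M (e - 1)] of determinants of values f_j(x_i) of functionals at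
    elements of M; this is used in the form that an ideal containing I(M) contains
    [minors M e] ([minors_sub_fitt0]) and that I_1(M) lies in [minors M (e - 1)]
    ([fitt1_sub_minors]).

    Let M be the direct sum of N1 and N2, of ranks e1 and e2. The product of
    [minors N1 e1] and [minors N2 e2] lies in [minors M e], hence in m^(e+1). As
    orders of elements add up in R ([ideal_exp_domain]), one of the summands, say
    N1, satisfies the inclusion of [minors N1 e1] in m^(e1+1). A minor of size
    e - 1 of a block matrix uses either all e1 columns of the first block, and
    then lies in m^e, or e1 - 1 of them and all e2 columns of the second block
    ([minors_sum_sub]). By hypothesis m^(e-1) is integral over I_1(M), so that the
    (e-1)-minors form a reduction of m^(e-1) ([integral_reduction]); by Nakayama's
    lemma the minors of the second kind suffice for this ([minors_sum_reduce]).

    This has two consequences. Firstly, [minors N2 e2] is a reduction of m^e2. So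
    for every discrete valuation ring V some determinant of e2 vectors of N2 has a
    value that is at most that of m^e2, and Cramer's rule shows that every vector
    with coordinates in m belongs to N2 V. As N2 is integrally closed, it consists
    of all these vectors, and is a sum of e2 copies of m ([full_module_iso]).
    Secondly, [minors N1 (e1 - 1)] is a reduction of m^(e1-1), so that N1 satisfies
    the same hypotheses as M. It is indecomposable, or it splits by induction on
    the rank ([splitting_induction]). *)

Set Implicit Arguments.
Unset Strict Implicit.
Unset Printing Implicit Defensive.

Import Order.TTheory GRing.Theory Num.Theory.
Local Open Scope classical_set_scope.
Local Open Scope quotient_scope.
Local Open Scope ring_scope.

(** * Spans, products and powers of ideals *)

Section Spans.
Variables (R : comNzRingType) (M : lmodType R).
Implicit Types (N : submodClosed M) (X : set M).

Lemma span_gen X x : X x -> x \in span X.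
Proof.
move=> Xx; apply/asboolP; exists [:: (1, x)]; split=> [p|].
  by rewrite inE => /eqP->.
by rewrite big_seq1 scale1r.
Qed.

Lemma span_sub X N : (forall x, X x -> x \in N) -> {subset span X <= N}.
Proof.
move=> XN x /asboolP[s [Xs ->]]; rewrite big_seq rpred_sum // => p /Xs/XN Np.
exact: rpredZ.
Qed.

Lemma span_range n (g : 'I_n -> M) x :
  x \in span (range g) -> exists a : 'I_n -> R, x = \sum_i a i *: g i.
Proof.
case/asboolP=> s []; elim: s x => [|p s IH] x sg ->.
  by exists (fun=> 0); rewrite big_nil big1 // => i _; rewrite scale0r.
have [|a Da] := IH _ _ erefl; first by move=> q qs; apply: sg; rewrite inE qs orbT.
have [i _ Di] : range g p.2 by apply: sg; rewrite inE eqxx.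
exists (fun k => a k + (if k == i then p.1 else 0)); rewrite big_cons Da addrC.
under [RHS]eq_bigr do rewrite scalerDl.
rewrite big_split /=; congr (_ + _).
rewrite (bigD1 i) //= eqxx Di big1 ?addr0 // => k /negPf->.
by rewrite scale0r.
Qed.

End Spans.

Section Ideals.
Variable R : comNzRingType.
Implicit Types (I J K : submodClosed R^o) (a b x y : R).

Lemma idealMl I a b : b \in I -> a * b \in I.
Proof. exact: rpredZ. Qed.

Lemma ideal0 I : (0 : R) \in I. Proof. exact: rpred0. Qed.

Lemma idealD I a b : a \in I -> b \in I -> a + b \in I.
Proof. exact: rpredD. Qed.

Lemma idealN I a : a \in I -> - a \in I.
Proof. by move=> Ia; rewrite -mulN1r; exact: idealMl. Qed.

Lemma idealB I a b : a \in I -> b \in I -> a - b \in I.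
Proof. by move=> Ia Ib; apply: idealD => //; exact: idealN. Qed.

Lemma ideal_sum (T : Type) (s : seq T) (P : pred T) I (F : T -> R) :
  (forall i, P i -> F i \in I) -> \sum_(i <- s | P i) F i \in I.
Proof. exact: rpred_sum. Qed.

Lemma idealMr I a b : a \in I -> a * b \in I.
Proof. by rewrite mulrC; exact: idealMl. Qed.

HB.instance Definition _ (I : {pred R}) n :=
  GRing.isSubmodClosed.Build R R^o (ideal_exp I n) (span_closed _).

Definition ideal_mul (I J : {pred R}) : {pred R^o} :=
  span [set x : R^o | exists a b, [/\ a \in I, b \in J & x = a * b]].
HB.instance Definition _ (I J : {pred R}) :=
  GRing.isSubmodClosed.Build R R^o (ideal_mul I J) (span_closed _).

Definition ideal_add (I J : {pred R}) : {pred R^o} :=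
  span [set x : R^o | x \in I \/ x \in J].
HB.instance Definition _ (I J : {pred R}) :=
  GRing.isSubmodClosed.Build R R^o (ideal_add I J) (span_closed _).

Lemma span_mul (X Y : set R^o) J :
  (forall x y, X x -> Y y -> x * y \in J) ->
  forall x y, x \in span X -> y \in span Y -> x * y \in J.
Proof.
move=> XYJ x y /asboolP[s [Xs ->]] /asboolP[t [Yt ->]].
rewrite mulr_suml big_seq ideal_sum // => p ps.
rewrite mulr_sumr big_seq ideal_sum // => q qt.
have -> : p.1 *: p.2 * (q.1 *: q.2) = (p.1 * q.1) * (p.2 * q.2).
  by rewrite /GRing.scale /=; ring.
by apply/idealMl/XYJ; [exact: Xs | exact: Yt].
Qed.

Lemma mem_ideal_mul (I J : {pred R}) a b :
  a \in I -> b \in J -> a * b \in ideal_mul I J.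
Proof. by move=> Ia Jb; apply: span_gen; exists a, b. Qed.

Lemma ideal_mul_sub (I J : {pred R}) K :
  (forall a b, a \in I -> b \in J -> a * b \in K) -> {subset ideal_mul I J <= K}.
Proof. by move=> IJK; refine (span_sub _) => x [a [b [Ia Jb ->]]]; exact: IJK. Qed.

Lemma mem_ideal_addl (I J : {pred R}) a : a \in I -> a \in ideal_add I J.
Proof. by move=> Ia; apply: span_gen; left. Qed.

Lemma mem_ideal_addr (I J : {pred R}) a : a \in J -> a \in ideal_add I J.
Proof. by move=> Ja; apply: span_gen; right. Qed.

Lemma ideal_add_sub (I J : {pred R}) K :
  {subset I <= K} -> {subset J <= K} -> {subset ideal_add I J <= K}.
Proof. by move=> IK JK; refine (span_sub _) => x [/IK|/JK]. Qed.

Lemma ideal_addP I J a :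
  a \in ideal_add I J -> exists b c, [/\ b \in I, c \in J & a = b + c].
Proof.
case/asboolP=> s []; elim: s a => [|p s IH] a sIJ ->.
  by exists 0, 0; rewrite !ideal0 big_nil addr0.
have [|b [c [Ib Jc Dbc]]] := IH _ _ erefl.
  by move=> q qs; apply: sIJ; rewrite inE qs orbT.
rewrite big_cons Dbc; have [|Ip|Jp] := sIJ p; first by rewrite inE eqxx.
  exists (p.1 *: p.2 + b), c; split=> //; last by rewrite addrA.
  by apply: idealD => //; exact: rpredZ.
exists b, (p.1 *: p.2 + c); split=> //; last by rewrite addrCA.
by apply: idealD => //; exact: rpredZ.
Qed.

Lemma ideal_exp_prod (I : {pred R}) n (f : 'I_n -> R) :
  (forall i, f i \in I) -> \prod_i f i \in ideal_exp I n.
Proof. by move=> If; apply: span_gen; exists f. Qed.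

Lemma ideal_exp_sub (I : {pred R}) n J :
  (forall f : 'I_n -> R, (forall i, f i \in I) -> \prod_i f i \in J) ->
  {subset ideal_exp I n <= J}.
Proof. by move=> IJ; apply: (@span_sub R R^o _ J) => x [f [If ->]]; exact: IJ. Qed.

Lemma ideal_exp0 (I : {pred R}) a : a \in ideal_exp I 0.
Proof.
have I1 : 1 \in ideal_exp I 0.
  have := @ideal_exp_prod I 0 (fun=> 0); rewrite big_ord0; apply.
  by case.
by rewrite -[a]mulr1; exact: idealMl.
Qed.

Lemma ideal_exp1 (I : {pred R}) a : a \in I -> a \in ideal_exp I 1.
Proof.
by move=> Ia; have := @ideal_exp_prod I 1 (fun=> a); rewrite big_ord1; apply.
Qed.

Lemma ideal_expD (I : {pred R}) n k a b :
  a \in ideal_exp I n -> b \in ideal_exp I k -> a * b \in ideal_exp I (n + k).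
Proof.
apply: span_mul => x y [f [If ->]] [g [Ig ->]]; apply: span_gen.
exists (fun i => match fintype.split i with inl j => f j | inr j => g j end); split.
  by move=> i; case: fintype.split.
rewrite big_split_ord /=; congr (_ * _); apply: eq_bigr => i _.
  by rewrite (unsplitK (inl _ i)).
by rewrite (unsplitK (inr _ i)).
Qed.

Lemma ideal_expD_sub (I : {pred R}) n k J :
  (forall a b, a \in ideal_exp I n -> b \in ideal_exp I k -> a * b \in J) ->
  {subset ideal_exp I (n + k) <= J}.
Proof.
move=> nkJ; apply: ideal_exp_sub => f If.
by rewrite big_split_ord; apply: nkJ; exact: ideal_exp_prod.
Qed.

Lemma ideal_expS (I : {pred R}) n a b :
  a \in I -> b \in ideal_exp I n -> a * b \in ideal_exp I n.+1.
Proof. by move=> Ia; rewrite -add1n; apply: ideal_expD; exact: ideal_exp1. Qed.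

Lemma ideal_exp_le (I : {pred R}) n k :
  (n <= k)%N -> {subset ideal_exp I k <= ideal_exp I n}.
Proof.
move=> /subnKC <-; apply: ideal_expD_sub => a b Ia _; exact: idealMr.
Qed.

Lemma ideal_exp_mono (I J : {pred R}) n :
  {subset I <= J} -> {subset ideal_exp I n <= ideal_exp J n}.
Proof.
by move=> IJ; apply: ideal_exp_sub => f If; apply: ideal_exp_prod => i; exact: IJ.
Qed.

Lemma ideal_exp1_sub I : {subset ideal_exp I 1 <= I}.
Proof. by apply: ideal_exp_sub => f If; rewrite big_ord1. Qed.

Lemma ideal_expX (I : {pred R}) n a : a \in I -> a ^+ n \in ideal_exp I n.
Proof.
by move=> Ia; elim: n => [|n IH]; rewrite ?ideal_exp0 // exprS ideal_expS.
Qed.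

Definition colon (J : {pred R}) x : {pred R^o} := [pred z | x * z \in J].

Lemma colon_closed J x : submod_closed (colon J x).
Proof.
split=> [|a u v]; rewrite !inE ?mulr0 ?ideal0 // => Ju Jv.
by rewrite mulrDr [_ *: _]mulrC mulrA idealD // idealMr.
Qed.
HB.instance Definition _ J x :=
  GRing.isSubmodClosed.Build R R^o (colon J x) (colon_closed J x).

Lemma colonE (J : {pred R}) x z : (z \in colon J x) = (x * z \in J).
Proof. by []. Qed.

(** A power of (x, y) is spanned by monomials. Peeling off one factor replaces
    J by the colon ideals of J by x and y, which is why J varies in the
    induction. *)
Lemma ideal_exp_monomials I x y n J :
  (forall a, a \in I -> exists b c, a = b * x + c * y) ->
  (forall i j, (i + j = n)%N -> x ^+ i * y ^+ j \in J) ->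
  {subset ideal_exp I n <= J}.
Proof.
move=> Ixy; elim: n J => [|n IH] J monJ.
  by move=> a _; rewrite -[a]mulr1 idealMl // -(mulr1 1) (monJ 0 0).
rewrite -add1n; apply: ideal_expD_sub => a b /ideal_exp1_sub/Ixy[c [d ->]] Inb.
rewrite mulrDl -!mulrA idealD // idealMl //.
  have : b \in colon J x; last by [].
  apply: IH Inb => i j ij; rewrite inE mulrA -exprS.
  by apply: monJ; rewrite addSn ij.
have : b \in colon J y; last by [].
apply: IH Inb => i j ij; rewrite inE mulrCA -exprS.
by apply: monJ; rewrite addnS ij.
Qed.

Lemma ideal_mul_expD (I J : {pred R}) n k a b :
  a \in ideal_mul J (ideal_exp I n) -> b \in ideal_exp I k ->
  a * b \in ideal_mul J (ideal_exp I (n + k)).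
Proof.
move=> Ja Ib; rewrite mulrC; suff : a \in colon (ideal_mul J (ideal_exp I (n + k))) b by [].
apply: ideal_mul_sub Ja => c d Jc Id.
rewrite colonE mulrCA [b * d]mulrC; exact: (mem_ideal_mul Jc (ideal_expD Id Ib)).
Qed.

End Ideals.

(** * Noetherian local rings *)

Section Noetherian.
Variable R : idomainType.
Implicit Types (I J : submodClosed R^o) (a b c : R).

Lemma span1P (a c : R) : (a : R^o) \in span [set c : R^o] -> exists b, a = b * c.
Proof.
case/asboolP=> s []; elim: s a => [|p s IH] a sc ->.
  by exists 0; rewrite big_nil mul0r.
have [|b Db] := IH _ _ erefl; first by move=> q qs; apply: sc; rewrite inE qs orbT.
have Dp : p.2 = c by apply: sc; rewrite inE eqxx.
by exists (p.1 + b); rewrite big_cons Db Dp mulrDl.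
Qed.

Lemma ascending_le (I : nat -> submodClosed R^o) :
  (forall k, {subset I k <= I k.+1}) ->
  forall n k, (n <= k)%N -> {subset I n <= I k}.
Proof.
move=> Iinc n k; elim: k => [|k IH]; first by rewrite leqn0 => /eqP->.
rewrite leq_eqVlt ltnS => /predU1P[-> //|/IH sub x /sub]; exact: Iinc.
Qed.

Lemma noetherian_acc (I : nat -> submodClosed R^o) :
  noetherian R -> (forall k, {subset I k <= I k.+1}) ->
  exists n, forall k, {subset I k <= I n}.
Proof.
move=> noeR Iinc.
have le := ascending_le Iinc.
pose X := [set x : R^o | exists k, x \in I k].
have memX x : x \in span X -> exists k, x \in I k.
  case/asboolP=> s []; elim: s x => [|p s IH] x sX ->.
    by exists 0%N; rewrite big_nil rpred0.
  have [|k Ik] := IH _ _ erefl; first by move=> q qs; apply: sX; rewrite inE qs orbT.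
  have [k' Ik'] : X p.2 by apply: sX; rewrite inE eqxx.
  exists (maxn k k'); rewrite big_cons rpredD //.
    by apply/rpredZ/le/Ik'; rewrite leq_maxr.
  by apply/le/Ik; rewrite leq_maxl.
have [n [g Dg]] := noeR (span X).
have gX i : exists k, g i \in I k.
  by apply: memX; rewrite Dg; apply: span_gen; exists i.
have [k kP] := choice gX; pose N := (\max_i k i)%N.
exists N => j x Ijx; have : x \in span X by apply: span_gen; exists j.
rewrite Dg; apply: span_sub => _ [i _ <-].
by apply: le (kP i); exact: (leq_bigmax i).
Qed.

End Noetherian.

Section Local.
Variables (R : idomainType) (m : submodClosed R^o).
Hypotheses (noeR : noetherian R) (locR : is_local m).
Implicit Types (I J : submodClosed R^o) (a b c x y t u : R).

Lemma one_notin_max : (1 : R) \notin m.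
Proof. by case: locR => -[]. Qed.

(** Otherwise dependent choice would give a strictly ascending chain of proper
    ideals that contain a. *)
Lemma mem_maximal a : a \isn't a GRing.unit -> exists2 J, is_maximal J & a \in J.
Proof.
move=> aN; apply: contrapT => noJ.
pose T J := a \in J /\ (1 : R) \notin J.
have step J : exists J', T J -> [/\ T J', {subset J <= J'} & ~ {subset J' <= J}].
  have [TJ|] := pselect (T J); last by exists J.
  apply: contrapT => noJ'; apply: noJ; exists J; last by case: TJ.
  split=> [|J' JJ' J'1]; first by case: TJ.
  apply: contrapT => J'J; apply: noJ'; exists J' => _; split=> //.
  by split=> //; apply: JJ'; case: TJ.
have [nxt nxtP] := choice step.
pose J0 : submodClosed R^o := span [set a : R^o].
have TJ k : T (iter k nxt J0).
  elim: k => [|k IH] /=; last by have [] := nxtP _ IH.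
  split; first exact: span_gen.
  apply/negP => /span1P[b Db]; move/negP: aN; apply; apply/unitrP.
  by exists b; rewrite [a * b]mulrC -Db.
have [|n nP] := @noetherian_acc R (fun k => iter k nxt J0) noeR.
  by move=> k; have [] := nxtP _ (TJ k).
have [_ _] := nxtP _ (TJ n); apply; exact: (nP n.+1).
Qed.

Lemma notin_max_unit a : a \notin m -> a \is a GRing.unit.
Proof.
move=> /negP maN; apply: contrapT => /negP/mem_maximal[J Jmax Ja]; apply: maN.
by rewrite -(locR.2 _ Jmax).
Qed.

Lemma unit_notin_max a : a \is a GRing.unit -> a \notin m.
Proof.
move=> aU; apply/negP => ma; have /negP := one_notin_max; apply.
by rewrite -(mulVr aU); exact: idealMl.
Qed.

Lemma proper_sub_max J : (1 : R) \notin J -> {subset J <= m}.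
Proof.
move=> /negP J1 a Ja; apply: contrapT => /negP/notin_max_unit aU; apply: J1.
by rewrite -(mulVr aU); exact: idealMl.
Qed.

Lemma subr1_unit t : t \in m -> 1 - t \is a GRing.unit.
Proof.
move=> mt; apply: notin_max_unit; apply/negP => m1t; have /negP := one_notin_max; apply.
by rewrite -(subrK t 1); exact: idealD.
Qed.

(** The common core of Krull's intersection theorem and of Nakayama's lemma for a
    principal ideal. Iterating the step yields d 0, d 1, ... such that d k and
    t d (k+1) agree modulo I. The ideals I + (d k) ascend, so that d (n+1) lies in
    I + (d n), hence in I + (t d (n+1)), for some n; as t is in m, this forces
    d (n+1) into I. The states z of type T may carry more than the element c z
    that is being divided. *)
Lemma noetherian_descent (T : Type) (P : T -> Prop) (c : T -> R) I t :
  t \in m ->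
  (forall z, P z -> exists z', P z' /\ c z - t * c z' \in I) ->
  forall z, P z -> c z \in I.
Proof.
move=> mt step z Pz.
have stepS (w : {z | P z}) : exists w' : {z | P z}, c (sval w) - t * c (sval w') \in I.
  case: w => w Pw; have [w' [Pw' Iw]] := step w Pw.
  by exists (exist _ w' Pw').
have [nxt nxtP] := choice stepS.
pose w k := iter k nxt (exist _ z Pz); pose d k := c (sval (w k)).
have dP k : d k - t * d k.+1 \in I by exact: nxtP.
have <- : d 0%N = c z by [].
move: dP; clearbody d => dP {w nxtP nxt stepS step}.
have [|n nP] := @noetherian_acc R (fun k => ideal_add I (span [set d k : R^o])) noeR.
  move=> k; apply: ideal_add_sub => a; first exact: mem_ideal_addl.
  case/span1P=> b ->; rewrite -(subrK (t * d k.+1) (d k)).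
  apply/idealMl/idealD; first by apply: mem_ideal_addl.
  by apply/idealMl/mem_ideal_addr/span_gen.
have mem_d : d n.+1 \in ideal_add I (span [set d n.+1 : R^o]).
  exact/mem_ideal_addr/span_gen.
have [i [j [Ii Sj Dd]]] := ideal_addP (nP n.+1 _ mem_d).
have [b Dj] := span1P Sj.
have Id : d n.+1 \in I.
  have -> : d n.+1 = (1 - b * t)^-1 * ((1 - b * t) * d n.+1).
    by rewrite mulKr // subr1_unit // idealMl.
  apply: idealMl.
  have -> : (1 - b * t) * d n.+1 = i + b * (d n - t * d n.+1)
    by rewrite mulrBl mul1r {1}Dd Dj; ring.
  by apply: idealD => //; exact: idealMl.
have down k : d k \in I -> d 0%N \in I.
  elim: k => // k IHk Ik; apply: IHk; rewrite -(subrK (t * d k.+1) (d k)).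
  by apply: idealD => //; exact: idealMl.
exact: down Id.
Qed.

Definition regular_pair x y : Prop :=
  [/\ x \in m, y \in m & forall a, a \in m -> exists b c, a = b * x + c * y].

Lemma regular_pairC x y : regular_pair x y -> regular_pair y x.
Proof.
case=> mx my mxy; split=> // a /mxy[b [c ->]].
by exists c, b; rewrite addrC.
Qed.

Lemma mem_span1 a c : (a * c : R^o) \in span [set c : R^o].
Proof. exact/idealMl/span_gen. Qed.

(** Modulo x the maximal ideal is generated by y, and [noetherian_descent] excludes
    that an element outside (x) be divisible by all powers of y modulo x. *)
Lemma adic_form x y a : regular_pair x y -> (a : R^o) \notin span [set x : R^o] ->
  exists u n c, u \is a GRing.unit /\ a = u * y ^+ n + x * c.
Proof.
case=> mx my mxy /negP xNa; apply: contrapT => aP; apply: xNa.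
pose P a := ~ exists u n c, u \is a GRing.unit /\ a = u * y ^+ n + x * c.
have {aP} : P a by [].
apply: (noetherian_descent (c := id) my) => {}a aP.
have /mxy[b [c Da]] : a \in m.
  apply: contrapT => /negP/notin_max_unit aU; apply: aP.
  by exists a, 0%N, 0; rewrite mulr0 addr0 mulr1.
exists c; split.
  case=> u [n [d [uU Dc]]]; apply: aP; exists u, n.+1, (b + y * d); split=> //.
  by rewrite Da Dc exprS; ring.
by rewrite Da [y * c]mulrC addrK; exact: mem_span1.
Qed.

Lemma prime_exp (Q : submodClosed R^o) a n : is_prime Q -> a ^+ n \in Q -> a \in Q.
Proof.
move=> prQ; elim: n => [|n IH]; first by case: prQ => /negP.
by rewrite exprS => /prQ.2[].
Qed.

End Local.

(** * Two-dimensional regular local rings *)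

Section RegularLocal.
Variables (R : idomainType) (m : submodClosed R^o).
Hypothesis R_reg : regular_local m 2.
Implicit Types (I J : submodClosed R^o) (a b c x y t u : R).

Let noeR : noetherian R. Proof. by case: R_reg. Qed.
Let locR : is_local m. Proof. by case: R_reg. Qed.

Lemma exists_regular_pair : exists x y, regular_pair m x y.
Proof.
case: R_reg => _ _ _ [g Dm]; exists (g ord0), (g ord_max); split.
- by rewrite Dm; apply: span_gen; exists ord0.
- by rewrite Dm; apply: span_gen; exists ord_max.
move=> a; rewrite Dm => /span_range[c ->]; exists (c ord0), (c ord_max).
rewrite big_ord_recl big_ord1 /GRing.scale /=.
by have -> : lift ord0 ord0 = ord_max :> 'I_2 by exact/val_inj.
Qed.

(** The middle term of a chain of three primes is neither zero nor maximal. *)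
Lemma intermediate_prime : exists2 Q : submodClosed R^o,
  is_prime Q /\ {subset Q <= m} /\ ~ {subset m <= Q} & exists2 q, q \in Q & q != 0.
Proof.
case: R_reg => _ _ [[P [prP ltP]] _] _; exists (P 1%N); last first.
  apply: contrapT => noq; case: (ltP 0%N isT).2 => q Pq.
  have [->|q0] := eqVneq q 0; first exact: rpred0.
  by case: noq; exists q.
have P2m : {subset P 2%N <= m}.
  by apply: (proper_sub_max noeR locR); case: (prP 2%N isT).
split; first exact: prP; split=> [a Pa|mP]; first exact/P2m/(ltP 1%N isT).1.
by case: (ltP 1%N isT).2 => a /P2m/mP.
Qed.

(** The instance of Krull's principal ideal theorem that makes x, y a regular
    sequence. Suppose that y ^+ n is in (x), and let Q be a prime strictly between
    0 and m; it does not contain x. Let p in Q have the least order i modulo x.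
    Then Q = (p) + x Q, hence Q = (p) by [noetherian_descent]. As i > 0, the n-th
    power of p is a multiple of x; since p is prime and does not divide x, it can
    be cancelled n times, which makes x a unit. *)
Lemma regular_pair_exp_notin x y n :
  regular_pair m x y -> (y ^+ n : R^o) \notin span [set x : R^o].
Proof.
move=> xy; have [mx my mxy] := xy; apply/negP => xyn.
have [Q [prQ [Qm mQ]] [q Qq q0]] := intermediate_prime.
have xQ : x \notin Q.
  apply/negP => Qx; apply: mQ => a /mxy[b [c ->]].
  apply: idealD; apply: idealMl => //; apply: (@prime_exp _ _ _ n prQ).
  by have [b' ->] := span1P xyn; exact: idealMl.
have divQ a : x * a \in Q -> a \in Q by case/prQ.2 => // Qx; rewrite Qx in xQ.
(* [i] is the least order of an element of [Q] modulo [x] *)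
have [|i] := @ex_minnP (fun i =>
  `[< exists u c, u \is a GRing.unit /\ u * y ^+ i + x * c \in Q >]).
  apply: contrapT => noi; have /negP[] := q0.
  suff : q \in (span [set 0 : R^o] : {pred R^o}).
    by case/span1P=> b ->; rewrite mulr0.
  apply: (@noetherian_descent _ m noeR locR _ (fun a => a \in Q) id _ x) => // a Qa.
  have [|/(adic_form noeR locR xy)[u [k [c [uU Da]]]]] := boolP (a \in span [set x : R^o]).
    case/span1P=> b Da; exists b; split; first by apply: divQ; rewrite mulrC -Da.
    by rewrite Da mulrC subrr ideal0.
  by case: noi; exists k; apply/asboolP; exists u, c; rewrite -Da.
move=> /asboolP[u [c [uU Qp]]] imin; set p := _ + _ in Qp.
have redQ a : a \in Q -> exists2 b, b \in Q & a - x * b \in span [set p : R^o].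
  move=> Qa; suff [b [d Da]] : exists b d, a = d * p + x * b.
    exists b; last by rewrite Da addrK; exact: mem_span1.
    apply: divQ; have -> : x * b = a - d * p by rewrite Da addrAC subrr add0r.
    by apply: idealB => //; exact: idealMl.
  have [|/(adic_form noeR locR xy)[v [k [d [vU Da]]]]] := boolP (a \in span [set x : R^o]).
    by case/span1P=> b Da; exists b, 0; rewrite mul0r add0r mulrC.
  have /subnK ik : (i <= k)%N.
    by apply: imin; apply/asboolP; exists v, d; rewrite -Da.
  exists (d - v * y ^+ (k - i) * u^-1 * c), (v * y ^+ (k - i) * u^-1).
  rewrite Da -{1}ik exprD /p.
  have -> : v * (y ^+ (k - i) * y ^+ i) = v * y ^+ (k - i) * (u^-1 * u) * y ^+ i.
    by rewrite mulVr // mulr1 mulrA.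
  by move: (u^-1) (k - i)%N => w j; ring.
have Qpr a : a \in Q -> exists b, a = b * p.
  move=> Qa; apply: span1P.
  apply: (@noetherian_descent _ m noeR locR _ (fun a => a \in Q) id _ x) Qa => // {}a Qa.
  by have [b Qb] := redQ _ Qa; exists b.
have i0 : (0 < i)%N.
  case: posnP => // Di; have := Qm _ Qp; rewrite /p Di mulr1 => mp.
  have /negP := unit_notin_max locR uU; case; rewrite -(addrK (x * c) u).
  by apply: idealB => //; exact: idealMr.
have pn : (p ^+ n : R^o) \in span [set x : R^o].
  rewrite -(subrK ((u * y ^+ i) ^+ n) (p ^+ n)); apply: idealD.
    by rewrite subrXX /p addrAC subrr add0r; apply/idealMr/idealMr/span_gen.
  rewrite exprMn -exprM -(prednK i0) mulSn exprD.
  by apply/idealMl/idealMr.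
have p0 : p != 0.
  by apply: contra_neq q0; have [b ->] := Qpr _ Qq => ->; rewrite mulr0.
elim: n pn {xyn} => [|n IH].
  case/span1P=> b D1; have /negP := (one_notin_max locR); case.
  by rewrite -[1]/(p ^+ 0) D1; exact: idealMl.
rewrite exprS; case/span1P=> b Db.
have Qb : b \in Q by apply: divQ; rewrite mulrC -Db; exact: idealMr.
have [d Dd] := Qpr _ Qb; apply: IH; have -> : p ^+ n = d * x; last exact: mem_span1.
by apply: (mulfI p0); rewrite Db Dd; ring.
Qed.

(** By [adic_form], an element that is nonzero modulo x is a unit times a power of
    y modulo x, and no power of y vanishes modulo x. *)
Lemma regular_pair_colon x y a : regular_pair m x y ->
  (y * a : R^o) \in span [set x : R^o] -> (a : R^o) \in span [set x : R^o].
Proof.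
move=> xy xya; apply: contrapT => /negP /(adic_form noeR locR xy)[u [n [c [uU Da]]]].
have /negP := regular_pair_exp_notin n.+1 xy; apply.
have -> : y ^+ n.+1 = u^-1 * (y * a - (y * c) * x).
  by rewrite Da exprS -[LHS]mul1r -(mulVr uU); ring.
by apply/idealMl/idealB => //; exact: mem_span1.
Qed.

Lemma regular_pair_neq0 x y : regular_pair m x y -> x != 0.
Proof.
move=> xy; apply/eqP => x0; have /negP := regular_pair_exp_notin 1 (regular_pairC xy); apply.
by rewrite x0 -[_ ^+ 1]/0; exact: ideal0.
Qed.

Lemma ideal_mul1P x J c :
  c \in ideal_mul (span [set x : R^o]) J -> exists2 a, a \in J & c = x * a.
Proof.
case/asboolP=> s []; elim: s c => [|p s IH] c sP ->.
  by exists 0; rewrite ?ideal0 // big_nil mulr0.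
have [|a Ja Da] := IH _ _ erefl; first by move=> r rs; apply: sP; rewrite inE rs orbT.
have [|b [d [/span1P[k ->] Jd Dp]]] := sP p; first by rewrite inE eqxx.
exists (p.1 * (k * d) + a); first by rewrite idealD // !idealMl.
by rewrite big_cons Da Dp /GRing.scale /=; ring.
Qed.

(** Among the monomials of degree n + 1 only y ^+ n.+1 is not divisible by x. *)
Lemma max_exp_split x y n a : regular_pair m x y -> a \in ideal_exp m n.+1 ->
  exists a0, exists2 a', a' \in ideal_exp m n & a = a0 * y ^+ n.+1 + x * a'.
Proof.
case=> mx my mxy man.
pose J : submodClosed R^o := ideal_add (span [set (y ^+ n.+1) : R^o])
                    (ideal_mul (span [set x : R^o]) (ideal_exp m n)).
suff Ja : a \in J.
  have [b [c [Sb Sc Da]]] := ideal_addP Ja.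
  have [a0 Db] := span1P Sb; have [a' ma' Dc] := ideal_mul1P Sc.
  by exists a0, a'; rewrite // -Db -Dc.
apply: (ideal_exp_monomials mxy _ man) => -[|i] j ij.
  by apply: mem_ideal_addl; rewrite mul1r -ij; exact: span_gen.
apply: mem_ideal_addr; rewrite exprS -mulrA; apply: mem_ideal_mul.
  exact: span_gen.
by case: ij => <-; apply: ideal_expD; exact: ideal_expX.
Qed.

(** The class of x is a nonzerodivisor in the associated graded ring: in the
    expression of x a from [max_exp_split], the coefficient of y ^+ n.+1 must be
    divisible by x. *)
Lemma ideal_exp_colon x y n a : regular_pair m x y ->
  x * a \in ideal_exp m n.+1 -> a \in ideal_exp m n.
Proof.
move=> xy /(max_exp_split xy)[a0 [a' ma' Dxa]].
have {Dxa} Da0 : a0 * y ^+ n.+1 = x * (a - a') by rewrite mulrBr Dxa addrK.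
have [b Db] : exists b, a0 = b * x.
  apply: span1P.
  have: a0 * y ^+ n.+1 \in span [set x : R^o] by rewrite Da0 mulrC; exact: mem_span1.
  elim: n.+1 => [|k IH]; first by rewrite mulr1.
  by rewrite exprS mulrCA => /(regular_pair_colon xy).
have -> : a = a' + b * y ^+ n.+1.
  apply: (mulfI (regular_pair_neq0 xy)); rewrite -[LHS](subrK (x * a')) -mulrBr -Da0 Db; ring.
apply: idealD => //; apply: idealMl; apply: (@ideal_exp_le _ m n n.+1) => //.
by apply: ideal_expX; case: xy.
Qed.

(** Modulo x the ring is a discrete valuation ring with uniformizer y, where the
    orders n and k of the two factors add up. *)
Lemma unit_form_domain x y n k a b u v d f : regular_pair m x y ->
  u \is a GRing.unit -> v \is a GRing.unit ->
  a = u * y ^+ n + x * d -> b = v * y ^+ k + x * f ->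
  a * b \notin ideal_exp m (n + k).+1.
Proof.
move=> xy uU vU Da Db; have [mx my _] := xy; apply/negP => mab.
have [c [e _ Dab]] := max_exp_split xy mab.
have wU : u * v - c * y \is a GRing.unit.
  apply: (notin_max_unit noeR locR); apply/negP => /idealD - /(_ _ (idealMl c my)).
  by rewrite subrK => muv; have := unit_notin_max locR (_ : u * v \is a GRing.unit);
    rewrite unitrM uU vU muv => /(_ isT).
have /negP := regular_pair_exp_notin (n + k) xy; apply.
have -> : y ^+ (n + k) =
    (u * v - c * y)^-1 * ((e - u * y ^+ n * f - v * y ^+ k * d - x * d * f) * x).
  apply: (mulrI wU); rewrite mulrA divrr // mul1r.
  move: Dab; rewrite Da Db exprS exprD => Dab.
  rewrite -[RHS]addr0 -(subrr ((u * y ^+ n + x * d) * (v * y ^+ k + x * f))).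
  by rewrite {2}Dab; ring.
exact/idealMl/mem_span1.
Qed.

(** The associated graded ring of m is a domain. An element of order n either has
    order n modulo x too, and [unit_form_domain] applies, or it agrees modulo
    m^(n+1) with x times an element of order n - 1; in that case
    [ideal_exp_colon] cancels x and the sum of the orders decreases. *)
Lemma ideal_exp_domain x y n k a b : regular_pair m x y ->
  a \in ideal_exp m n -> a \notin ideal_exp m n.+1 ->
  b \in ideal_exp m k -> b \notin ideal_exp m k.+1 ->
  a * b \notin ideal_exp m (n + k).+1.
Proof.
move=> xy; have [mx my _] := xy.
(* either [c] has a unit coefficient at [y ^+ l], or it agrees with [x * d] up to
   terms of higher order *)
have split_form l c : c \in ideal_exp m l -> c \notin ideal_exp m l.+1 ->
    (exists u d, [/\ u \is a GRing.unit & c = u * y ^+ l + x * d]) \/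
    (exists2 d, l = (l.-1).+1 &
      [/\ d \in ideal_exp m l.-1, d \notin ideal_exp m l
        & c - x * d \in ideal_exp m l.+1]).
  case: l => [|l] mc mNc.
    left; exists c, 0; split; last by rewrite mulr1 mulr0 addr0.
    apply: (notin_max_unit noeR locR); apply: contra mNc; exact: ideal_exp1.
  have [c0 [d md Dc]] := max_exp_split xy mc.
  have [mc0|/(notin_max_unit noeR locR) c0U] := boolP (c0 \in m); last by left; exists c0, d.
  have cxd : c - x * d \in ideal_exp m l.+2.
    by rewrite Dc addrK; apply: ideal_expS => //; exact: ideal_expX.
  right; exists d => //; split=> //; apply: contra mNc => md1.
  by rewrite -(subrK (x * d) c); apply: idealD => //; exact: ideal_expS.
have xform l l' c d e : l = (l.-1).+1 -> c - x * d \in ideal_exp m l.+1 ->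
    e \in ideal_exp m l' -> c * e \in ideal_exp m (l + l').+1 ->
    d * e \in ideal_exp m (l.-1 + l').+1.
  move=> Dl mcd me mce; apply: (ideal_exp_colon xy).
  have -> : x * (d * e) = c * e - (c - x * d) * e by ring.
  rewrite -[(l.-1 + l').+1]addSn -Dl; apply: idealB => //.
  by rewrite -addSn; exact: ideal_expD.
have [s] := ubnP (n + k)%N.
elim: s n k a b => // s IH n k a b; rewrite ltnS => nks ma mNa mb mNb.
have [[u [d [uU Da]]]|[d Dn [md mNd mad]]] := split_form _ _ ma mNa; last first.
  apply/negP => mab; have /negP[] : d * b \notin ideal_exp m (n.-1 + k).+1.
    by apply: IH; rewrite // ?(addnC _ n.-1) -?addSn -Dn.
  exact: (xform n k a).
have [[v [f [vU Db]]]|[f Dk [mf mNf mbf]]] := split_form _ _ mb mNb; last first.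
  apply/negP => mab; have /negP[] : f * a \notin ideal_exp m (k.-1 + n).+1.
    by apply: IH; rewrite // -?addSn -Dk // addnC.
  by apply: (xform k n b); rewrite // mulrC addnC.
exact: (unit_form_domain xy uU vU Da Db).
Qed.

End RegularLocal.

(** * Freeness of the dual *)

Section FiniteGeneration.
Variables (R : idomainType) (U : lmodType R).
Implicit Types (N : submodClosed U) (phi : {linear U -> R^o}).

Definition sub_ker phi N : {pred U} := [pred u | (u \in N) && (phi u == 0)].

Lemma sub_ker_closed phi N : submod_closed (sub_ker phi N).
Proof.
split=> [|a u v]; rewrite !inE ?rpred0 ?linear0 ?eqxx //.
move=> /andP[Nu /eqP u0] /andP[Nv /eqP v0]; rewrite linearP u0 v0 scaler0 addr0.
by rewrite eqxx andbT rpredD // rpredZ.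
Qed.
HB.instance Definition _ phi N :=
  GRing.isSubmodClosed.Build R U (sub_ker phi N) (sub_ker_closed phi N).

Definition sub_im phi N : {pred R^o} := [pred a | `[<exists2 u, u \in N & a = phi u>]].

Lemma sub_im_closed phi N : submod_closed (sub_im phi N).
Proof.
split=> [|a b c]; first by apply/asboolP; exists 0; rewrite ?rpred0 ?linear0.
move=> /asboolP[u Nu ->] /asboolP[v Nv ->]; apply/asboolP.
by exists (a *: u + v); rewrite ?linearP // rpredD // rpredZ.
Qed.
HB.instance Definition _ phi N :=
  GRing.isSubmodClosed.Build R R^o (sub_im phi N) (sub_im_closed phi N).

(** The functionals embed N in R^q. Generators of N are those of the kernel of the
    last functional on N, together with lifts of generators of its image. *)
Lemma noetherian_submod_fg (phi : nat -> {linear U -> R^o}) q N :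
  noetherian R ->
  (forall u, u \in N -> (forall i, (i < q)%N -> phi i u = 0) -> u = 0) ->
  exists2 s : seq U, (forall u, u \in s -> u \in N) &
    forall u, u \in N -> u \in span [set v | v \in s].
Proof.
move=> noeR; elim: q N => [|q IH] N injN.
  by exists [::] => // u Nu; rewrite (injN u) ?rpred0.
have [|s sN Ns] := IH (sub_ker (phi q) N).
  move=> u /andP[Nu /eqP u0] uq; apply: injN => // i; rewrite ltnS leq_eqVlt.
  by case/predU1P=> [->|/uq].
have [n [g Dg]] := noeR (sub_im (phi q) N).
have imP i : exists u, u \in N /\ g i = phi q u.
  have /asboolP[u] : g i \in sub_im (phi q) N by rewrite Dg; apply: span_gen; exists i.
  by exists u.
have [w wP] := choice imP.
exists (s ++ codom w) => u.
  by rewrite mem_cat => /orP[/sN/andP[]//|/codomP[i ->]]; case: (wP i).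
move=> Nu; have [c Dc] : exists c : 'I_n -> R, phi q u = \sum_i c i *: g i.
  by apply: span_range; rewrite -Dg; apply/asboolP; exists u.
pose v := \sum_i c i *: w i.
have Nv : v \in N by apply: rpred_sum => i _; apply: rpredZ; case: (wP i).
rewrite -(subrK v u); apply: rpredD.
  have /Ns : u - v \in sub_ker (phi q) N.
    apply/andP; split; first by rewrite -scaleN1r rpredD // rpredZ.
    apply/eqP; rewrite linearB Dc linear_sum -sumrB big1 // => i _.
    by rewrite linearZ (wP i).2 subrr.
  by apply: span_sub => z sz; apply: span_gen; rewrite /= mem_cat (_ : z \in s).
by apply: rpred_sum => i _; apply/rpredZ/span_gen; rewrite /= mem_cat codom_f orbT.
Qed.

End FiniteGeneration.

Section Dual.
Variables (R : idomainType) (M : lmodType R).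
Implicit Types (f : dual M).

HB.instance Definition _ f :=
  GRing.isLinear.Build R M R^o *:%R (dual_fun f)
    (fun a u v => linearP (f : {linear M -> R^o}) a u v).

Definition mk_dual (h : M -> R^o) (h_lin : linear h) : dual M :=
  HB.pack_for {linear M -> R^o} h (GRing.isLinear.Build R M R^o *:%R h h_lin).

Lemma mk_dualE h h_lin x : dual_fun (@mk_dual h h_lin) x = h x.
Proof. by []. Qed.

Lemma dual_fun0 x : dual_fun (0 : dual M) x = 0.
Proof. by []. Qed.

Lemma dual_funZ a f x : dual_fun (a *: f) x = a * dual_fun f x.
Proof. by []. Qed.

Lemma dual_fun_sum n (c : 'I_n -> R) (f : 'I_n -> dual M) x :
  dual_fun (\sum_i c i *: f i) x = \sum_i c i * dual_fun (f i) x.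
Proof.
rewrite -[LHS]/(eval_at x _) linear_sum.
by apply: eq_bigr => i _; rewrite linearZ.
Qed.

(** As a consequence, dual M / a (dual M) embeds in the module of functionals on M
    with values in R / (a). *)
Lemma dual_div f a : a != 0 ->
  (forall x, (dual_fun f x : R^o) \in span [set a : R^o]) -> exists g, f = a *: g.
Proof.
move=> a0 fa; have /choice[h hP] x : exists b, dual_fun f x = b * a by apply: span1P.
have h_lin : linear (h : M -> R^o).
  by move=> b u v; apply: (mulIf a0); rewrite -hP linearP /= !hP mulrDl -scalerAl.
exists (mk_dual h_lin); apply: dual_ext => x; rewrite dual_funZ mk_dualE hP.
exact: mulrC.
Qed.

Lemma dual_fg : noetherian R -> finitely_generated M -> finitely_generated (dual M).
Proof.
move=> noeR [q [g Dg]].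
pose phi i : {linear dual M -> R^o} :=
  if insub i is Some k then to_bidual (g k) : {linear dual M -> R^o} else \0.
have [|s _ Ns] := @noetherian_submod_fg _ _ phi q (span setT) noeR.
  move=> f _ fq; apply: dual_ext => x; have [a ->] := Dg x.
  rewrite !linear_sum big1 ?big1 // => i _; rewrite linearZ.
  have fi : dual_fun f (g i) = 0 by have := fq i (ltn_ord i); rewrite /phi valK.
  by rewrite /= fi scaler0.
exists (size s), (fun i : 'I_(size s) => s`_i) => f.
have /Ns : f \in span setT by exact: span_gen.
move=> fs; apply: span_range; apply: span_sub fs => z /= zs; apply: span_gen.
have zi : (index z s < size s)%N by rewrite index_mem.
by exists (Ordinal zi); rewrite //= nth_index.
Qed.

End Dual.

Definition is_basis (R : comNzRingType) (U : lmodType R) n (f : 'I_n -> U) : Prop :=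
  generates f /\ forall c : 'I_n -> R, \sum_i c i *: f i = 0 -> forall i, c i = 0.

Lemma generates_drop (R : comUnitRingType) (U : lmodType R) n (f : 'I_n.+1 -> U)
    (c : 'I_n.+1 -> R) k :
  generates f -> c k \is a GRing.unit -> \sum_i c i *: f i = 0 ->
  generates (f \o lift k).
Proof.
move=> genf cU fc0.
have fk : f k = \sum_i (- (c k)^-1 * c (lift k i)) *: f (lift k i).
  move: fc0; rewrite (bigD1_ord k) //= => /eqP; rewrite addr_eq0 => /eqP fc.
  rewrite -[LHS]scale1r -(mulVr cU) -scalerA fc scalerN -scaleNr scaler_sumr.
  by apply: eq_bigr => i _; rewrite scalerA.
move=> u; have [a ->] := genf u; rewrite (bigD1_ord k) //= fk scaler_sumr -big_split /=.
exists (fun i => a k * (- (c k)^-1 * c (lift k i)) + a (lift k i)).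
by apply: eq_bigr => i _; rewrite scalerDl scalerA.
Qed.

Section DualFree.
Variables (R : idomainType) (m : submodClosed R^o).
Hypothesis R_reg : regular_local m 2.

(** A minimal generating family is a basis. By minimality the coefficients of a
    relation are in m. If y g is in x (dual M), then so is g, because y is a
    nonzerodivisor modulo x; so a relation modulo x (dual M) can be divided by y
    indefinitely, and [noetherian_descent] puts its coefficients in (x). Therefore
    a relation can be divided by x indefinitely, which makes it trivial. *)
Theorem dual_free (M : lmodType R) :
  finitely_generated M -> exists n (f : 'I_n -> dual M), is_basis f.
Proof.
have [noeR locR _ _] := R_reg => M_fg.
have [x [y xy]] := exists_regular_pair R_reg; have [mx my mxy] := xy.
have x0 := regular_pair_neq0 R_reg xy.
have exn : exists n, `[< exists f : 'I_n -> dual M, generates f >].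
  by have [n [f Df]] := dual_fg noeR M_fg; exists n; apply/asboolP; exists f.
have [n /asboolP[f genf] nmin] := ex_minnP exn; exists n, f; split=> //.
have relm (c : 'I_n -> R) : \sum_i c i *: f i = 0 -> forall i, c i \in m.
  move=> fc0 i; apply: contrapT => /negP/(notin_max_unit noeR locR) ciU.
  case: n => [|n] in f genf nmin c fc0 i ciU *; first by case: i ciU.
  have /nmin : `[< exists f : 'I_n -> dual M, generates f >].
    by apply/asboolP; exists (f \o lift i); exact: (generates_drop genf ciU).
  by rewrite ltnn.
have divx (g : dual M) : (exists h, y *: g = x *: h) -> exists h, g = x *: h.
  case=> h gh; apply: (@dual_div _ M g x x0) => z; apply: (regular_pair_colon R_reg xy).
  by rewrite -dual_funZ gh dual_funZ mulrC; exact: mem_span1.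
have relx (c : 'I_n -> R) :
    (exists h, \sum_i c i *: f i = x *: h) -> forall i, (c i : R^o) \in span [set x : R^o].
  move=> fcx i; pose P (c : 'I_n -> R) := exists h, \sum_i c i *: f i = x *: h.
  apply: (noetherian_descent noeR locR (P := P) (c := fun c => c i) my) fcx => {}c [h fch].
  have [a Dh] := genf h.
  have mca j : c j - x * a j \in m.
    apply: (relm (fun j => c j - x * a j)) => {j}.
    under eq_bigr do rewrite scalerBl.
    rewrite sumrB fch Dh scaler_sumr -sumrB big1 // => j _.
    by rewrite scalerA subrr.
  have /choice[d dP] j : exists d, exists b, c j = x * b + y * d.
    have [b [d Dc]] := mxy _ (mca j); exists d, (a j + b).
    by rewrite -(subrK (x * a j) (c j)) Dc; ring.
  exists d; split; last first.
    by have [b ->] := dP i; rewrite addrK mulrC; exact: mem_span1.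
  apply: divx; have /choice[b Dc] := dP; exists (h - \sum_j b j *: f j).
  rewrite scalerBr -fch !scaler_sumr -sumrB; apply: eq_bigr => j _.
  by rewrite !scalerA -scalerBl Dc addrAC subrr add0r.
move=> c fc0 i; suff : (c i : R^o) \in span [set 0 : R^o].
  by case/span1P=> b ->; rewrite mulr0.
pose P (c : 'I_n -> R) := \sum_i c i *: f i = 0.
apply: (noetherian_descent noeR locR (P := P) (c := fun c => c i) mx) fc0 => {}c fc0.
have /choice[d Dc] j : exists d, c j = d * x.
  by apply/span1P/relx; exists 0; rewrite scaler0.
exists d; split; last by rewrite Dc mulrC subrr; exact: rpred0.
apply: dual_ext => z; apply: (mulfI x0); rewrite dual_fun0 mulr0 -dual_funZ.
suff -> : x *: (\sum_j d j *: f j) = 0 by [].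
rewrite -[RHS]fc0 scaler_sumr; apply: eq_bigr => j _.
by rewrite scalerA mulrC -Dc.
Qed.

End DualFree.

(** * Ideals of minors *)

Section QuotientMap.
Variables (R : comNzRingType) (M : lmodType R) (N : submodClosed M).

(** The projection with the module type as codomain, so that it can be declared
    linear. *)
Definition quot_pi (x : M) : quot_mod N := \pi_(Quotient.quot (submod_zmod N)) x.

Lemma quot_pi_linear : linear quot_pi.
Proof.
by move=> a x y; rewrite /quot_pi -pi_addM -pi_scale.
Qed.
HB.instance Definition _ :=
  GRing.isLinear.Build R M (quot_mod N) *:%R quot_pi quot_pi_linear.

Lemma quot_pi_eq0 x : (quot_pi x == 0) = (x \in N).
Proof.
rewrite -(linear0 quot_pi) /quot_pi.
have := Quotient.idealrBE (submod_zmod N) x 0; rewrite subr0 => ->.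
by [].
Qed.

Lemma quot_pi_surj q : exists x, q = quot_pi x.
Proof. by elim/quot_modW: q => x; exists x. Qed.

End QuotientMap.

Section Minors.
Variables (R : idomainType) (M : lmodType R).

(** As all functionals are allowed, this ideal does not depend on a basis. For M
    with bidual F of rank e, it is Fitt_(e - s) of F / M. *)
Definition minors s : {pred R^o} :=
  span [set d : R^o | exists (f : 'I_s -> dual M) (x : 'I_s -> M),
    d = \det (\matrix_(i, j) dual_fun (f j) (x i))].
HB.instance Definition _ s :=
  GRing.isSubmodClosed.Build R R^o (minors s) (span_closed _).

Lemma mem_minors s (f : 'I_s -> dual M) (x : 'I_s -> M) :
  \det (\matrix_(i, j) dual_fun (f j) (x i)) \in minors s.
Proof. by apply: span_gen; exists f, x. Qed.

Lemma minors_gen s (I : submodClosed R^o) :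
  (forall (f : 'I_s -> dual M) (x : 'I_s -> M),
    \det (\matrix_(i, j) dual_fun (f j) (x i)) \in I) -> {subset minors s <= I}.
Proof. by move=> sI; refine (span_sub _) => _ [f [x ->]]. Qed.

(** Laplace expansion, one column at a time: the expanded columns contribute
    entries in I, and an s-minor with columns in S remains. *)
Lemma minors_laplace N (B : 'M[R]_N) (S : {set 'I_N}) s (I : submodClosed R^o)
    (f : 'I_N -> dual M) (x : 'I_N -> M) :
  (forall i j, j \in S -> B i j = dual_fun (f j) (x i)) ->
  (forall i j, B i j \in I) -> (s <= #|S|)%N ->
  \det B \in ideal_mul (minors s) (ideal_exp I (N - s)).
Proof.
elim: N => [|N IH] in B S f x * => BS BI sS.
all: have SN := leq_trans sS (max_card (mem S)); rewrite card_ord in SN.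
  have s0 : s = 0%N by apply/eqP; rewrite -leqn0.
  rewrite -[\det B]mulr1; apply: mem_ideal_mul; last exact: ideal_exp0.
  subst s; have -> : B = \matrix_(i, j) dual_fun (f j) (x i) by apply/matrixP => -[].
  exact: mem_minors.
have [sN|Ns] := leqP N.+1 s.
  have Ds : s = N.+1 by apply/eqP; rewrite eqn_leq sN andbT.
  have ST : S = [set: 'I_N.+1]%SET.
    by apply/eqP; rewrite eqEcard finset.subsetT cardsT card_ord (leq_trans sN).
  subst s; rewrite -[\det B]mulr1; apply: mem_ideal_mul; last by rewrite subnn; exact: ideal_exp0.
  have -> : B = \matrix_(i, j) dual_fun (f j) (x i).
    by apply/matrixP => i j; rewrite mxE BS // ST finset.in_setT.
  exact: mem_minors.
have [j0 sSj] : exists j0, (s <= #|S :\ j0|%SET)%N.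
  have [ST|] := eqVneq S [set: 'I_N.+1]%SET.
    exists ord0; have := cardsD1 ord0 S; rewrite {1 2}ST cardsT card_ord finset.in_setT.
    by rewrite add1n => -[<-].
  rewrite -finset.subTset => /subsetPn[j _ jS]; exists j.
  by have := cardsD1 j S; rewrite (negPf jS) add0n => <-.
rewrite (expand_det_col _ j0); apply: ideal_sum => i _.
rewrite /cofactor mulrCA; apply: idealMl.
have Sj : (s <= #|[set j | lift j0 j \in S]%SET|)%N.
  apply: leq_trans sSj _; rewrite -(card_imset _ (@lift_inj _ j0)).
  apply/subset_leq_card/fintype.subsetP => j; rewrite !inE => /andP[jj0 Sj].
  case: (unliftP j0 j) => [k Dj|Dj]; last by rewrite Dj eqxx in jj0.
  by apply/imsetP; exists k; rewrite ?inE -Dj.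
have : \det (row' i (col' j0 B)) \in ideal_mul (minors s) (ideal_exp I (N - s)).
  apply: (IH _ _ (f \o lift j0) (x \o lift i) _ _ Sj) => i' j'; rewrite !mxE //.
  by rewrite inE => /BS->.
rewrite subSn // -[(N - s).+1]addn1 [B i j0 * _]mulrC => Dd.
exact: (ideal_mul_expD Dd (ideal_exp1 (BI i j0))).
Qed.

Corollary minors_laplace0 N (B : 'M[R]_N) (S : {set 'I_N}) s
    (f : 'I_N -> dual M) (x : 'I_N -> M) :
  (forall i j, j \in S -> B i j = dual_fun (f j) (x i)) -> (s <= #|S|)%N ->
  \det B \in minors s.
Proof.
move=> BS sS; have /minors_laplace /(_ _ sS) := BS; move=> /(_ (span setT)) H.
apply: ideal_mul_sub (H _) => [a b sa _|i j]; first exact: idealMr.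
exact: span_gen.
Qed.

(** Multilinearity in the columns; c may take the same value twice, and then
    contributes 0. *)
Lemma det_sum_cols s n (C : 'I_s -> 'I_n -> R) (X : 'I_s -> 'I_n -> R) :
  \det (\matrix_(i < s, j < s) \sum_k C j k * X i k) =
  \sum_(c : {ffun 'I_s -> 'I_n}) (\prod_j C j (c j)) * \det (\matrix_(i, j) X i (c j)).
Proof.
rewrite -[LHS]det_tr {1}/determinant.
under eq_bigr => p _ do under eq_bigr => i _ do rewrite !mxE.
under eq_bigr => p _ do rewrite bigA_distr_bigA big_distrr /=.
rewrite exchange_big /=; apply: eq_bigr => c _.
rewrite -[\det _]det_tr /determinant big_distrr /=; apply: eq_bigr => p _.
rewrite big_split /= mulrCA; congr (_ * (_ * _)).
by apply: eq_bigr => i _; rewrite !mxE.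
Qed.

Lemma minors_basis n (b : 'I_n -> dual M) s (I : submodClosed R^o) :
  generates b ->
  (forall (c : 'I_s -> 'I_n) (x : 'I_s -> M),
    \det (\matrix_(i, j) dual_fun (b (c j)) (x i)) \in I) -> {subset minors s <= I}.
Proof.
move=> genb bI; apply: minors_gen => f x.
have /choice[C DC] j := genb (f j).
have -> : \matrix_(i, j) dual_fun (f j) (x i) =
    \matrix_(i, j) \sum_k C j k * dual_fun (b k) (x i).
  by apply/matrixP => i j; rewrite !mxE DC dual_fun_sum.
rewrite det_sum_cols; apply: ideal_sum => c _.
exact/idealMl/bI.
Qed.

End Minors.

(** * Fitting ideals of the cokernel of the bidual map *)

Section Fitting.
Variables (R : idomainType) (M : lmodType R) (e : nat) (b : 'I_e -> dual M).
Hypothesis b_basis : is_basis b.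
Local Notation qpi := (@quot_pi R _ (@bidual_image R M)).

(** Expanding along the one row i0 that does not come from an element of M costs at
    most one column of S. *)
Lemma minors_laplace_row N (B : 'M[R]_N) (i0 : 'I_N) (S : {set 'I_N}) s
    (f : 'I_N -> dual M) (x : 'I_N -> M) :
  (forall i j, i != i0 -> j \in S -> B i j = dual_fun (f j) (x i)) ->
  (s < #|S|)%N -> \det B \in minors M s.
Proof.
case: N => [|N] in B i0 S f x *; first by case: i0.
move=> BS sS; rewrite (expand_det_row _ i0); apply: ideal_sum => j _.
rewrite /cofactor; do 2!apply: idealMl.
pose S' := [set j' | lift j j' \in S]%SET.
apply: (@minors_laplace0 _ _ _ _ S' _ (f \o lift j) (x \o lift i0)) => [i' j'|].
  by rewrite inE !mxE => /BS-> //; rewrite eq_sym neq_lift.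
rewrite -ltnS (leq_trans sS) // (cardsD1 j) addnC -[(#|S'|).+1]addn1 leq_add ?leq_b1 //.
rewrite -(card_imset _ (@lift_inj _ j)).
apply/subset_leq_card/fintype.subsetP => k; rewrite !inE => /andP[jk Sk].
case: (unliftP j k) => [k' Dk|Dk]; last by rewrite Dk eqxx in jk.
by apply/imsetP; exists k'; rewrite ?inE -Dk.
Qed.

Lemma dual_basisP : exists eps : 'I_e -> dual (dual M),
  (forall j l, dual_fun (eps j) (b l) = (j == l)%:R) /\
  forall phi : dual (dual M), phi = \sum_j dual_fun phi (b j) *: eps j.
Proof.
have [genb freeb] := b_basis; have [a aP] := choice genb.
have a_uniq f c : f = \sum_i c i *: b i -> a f =1 c.
  move=> Df i; apply/eqP; rewrite -subr_eq0; apply/eqP.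
  apply: (freeb (fun i => a f i - c i)); under eq_bigr do rewrite scalerBl.
  by rewrite sumrB -aP -Df subrr.
have a_lin j : linear ((fun f => a f j) : dual M -> R^o).
  move=> c f g; apply: (a_uniq _ (fun j => c * a f j + a g j)).
  rewrite {1}(aP f) {1}(aP g) scaler_sumr -big_split; apply: eq_bigr => i _.
  by rewrite /= scalerDl scalerA.
exists (fun j => mk_dual (a_lin j)); split=> [j l|phi].
  rewrite mk_dualE (a_uniq _ (fun j => (j == l)%:R)) // (bigD1 l) //= eqxx scale1r.
  by rewrite big1 ?addr0 // => i /negPf->; rewrite scale0r.
apply: dual_ext => f; rewrite dual_fun_sum {1}(aP f) linear_sum.
by apply: eq_bigr => i _; rewrite linearZ mulrC.
Qed.

Lemma mem_relation_minors (Q : lmodType R) n (g : 'I_n -> Q) j k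
    (A : 'M[R]_(k, n)) (f : 'I_k -> 'I_n) :
  k = (n - j)%N -> (forall i, \sum_l A i l *: g l = 0) ->
  relation_minors j g (\det (colsub f A)).
Proof. by move=> Dk; subst k => Ag; exists A, f. Qed.

(** The basis of F that is dual to b generates F / M, and the relations between its
    classes are the coordinate vectors of the elements of M. *)
Lemma minors_sub_fitt0 (I : submodClosed R^o) :
  {subset fitt0_bidual M <= I} -> {subset minors M e <= I}.
Proof.
move=> F0I; have [genb _] := b_basis; have [eps [_ epsP]] := dual_basisP.
apply: (minors_basis genb) => c x; apply: F0I; apply/asboolP.
pose g j : bidual_quot M := qpi (eps j).
exists e, g; split.
  move=> u; have [phi ->] := quot_pi_surj u; exists (fun j => dual_fun phi (b j)).
  by rewrite {1}(epsP phi) linear_sum; apply: eq_bigr => j _; rewrite linearZ.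
apply: span_gen.
have -> : \matrix_(i, j) dual_fun (b (c j)) (x i) =
  colsub c (\matrix_(i, j) dual_fun (b j) (x i)) by apply/matrixP => i j; rewrite !mxE.
apply: mem_relation_minors => [|i]; first by rewrite subn0.
transitivity (qpi (to_bidual (x i))); last first.
  by apply/eqP; rewrite quot_pi_eq0; apply/asboolP; exists (x i).
rewrite {1}(epsP (to_bidual (x i))) linear_sum; apply: eq_bigr => j _.
by rewrite linearZ mxE.
Qed.

(** The k-th row of G holds the coordinates of a lift of g k to F, and H expresses
    the basis of F by these lifts modulo M. So the rows of A G, for relations A
    between the g k, and those of 1 - H G are coordinate vectors of elements of
    M. *)
Lemma bidual_generators n (g : 'I_n -> bidual_quot M) : generates g ->
  exists (G : 'M[R]_(n, e)) (H : 'M[R]_(e, n)),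
  (forall k (A : 'M[R]_(k, n)), (forall i, \sum_l A i l *: g l = 0) ->
     exists x : 'I_k -> M, forall i j, (A *m G) i j = dual_fun (b j) (x i)) /\
  (exists z : 'I_e -> M, forall i j, (1%:M - H *m G) i j = dual_fun (b j) (z i)).
Proof.
move=> geng; have [eps [epsb epsP]] := dual_basisP.
have [gam gamP] := choice (fun k => quot_pi_surj (g k)).
have inM (phi : dual (dual M)) : qpi phi = 0 ->
    exists x, forall j, dual_fun phi (b j) = dual_fun (b j) x.
  by move/eqP; rewrite quot_pi_eq0 => /asboolP[x ->]; exists x.
have /choice[h hP] j := geng (qpi (eps j)).
exists (\matrix_(k, j) dual_fun (gam k) (b j)), (\matrix_(j, k) h j k); split.
  move=> k A Ag.
  have /choice[x xP] i : exists x, forall j,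
      dual_fun (\sum_l A i l *: gam l) (b j) = dual_fun (b j) x.
    apply: inM; rewrite linear_sum -[RHS](Ag i); apply: eq_bigr => l _.
    by rewrite linearZ gamP.
  exists x => i j; rewrite -xP dual_fun_sum mxE.
  by apply: eq_bigr => l _; rewrite mxE.
have /choice[z zP] i : exists x, forall j,
    dual_fun (eps i - \sum_l h i l *: gam l) (b j) = dual_fun (b j) x.
  apply: inM; rewrite linearB linear_sum /= (hP i) -sumrB big1 // => l _.
  by rewrite linearZ gamP subrr.
exists z => i j; rewrite -zP !mxE -[RHS]/(dual_fun _ _ - dual_fun _ _).
rewrite dual_fun_sum epsb; congr (_ - _).
by apply: eq_bigr => l _; rewrite !mxE.
Qed.

(** Independence of the Fitting ideal from the generators. Border A with the last
    unit row, so that the determinant of the result D is the minor in question.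
    Multiplication by [block_mx 1 G 0 1] turns [block_mx D 0 (- H) 1] into a matrix
    whose last e columns hold coordinates of elements of M, except in the row of
    the unit vector, so that [minors_laplace_row] applies. *)
Lemma fitt1_minor_last n (g : 'I_(n + 1) -> bidual_quot M) (A : 'M[R]_(n, n + 1)) :
  generates g -> (forall i, \sum_l A i l *: g l = 0) ->
  \det (lsubmx A) \in minors M (e - 1).
Proof.
move=> geng Ag; have [G [H [AP [z zP]]]] := bidual_generators geng.
have [x xP] := AP _ _ Ag.
pose D : 'M[R]_(n + 1) := col_mx A (row_mx 0 1).
have <- : \det D = \det (lsubmx A).
  have -> : D = block_mx (lsubmx A) (rsubmx A) 0 1 by rewrite /block_mx hsubmxK.
  by rewrite det_ublock det1 mulr1.
pose Z := block_mx D (D *m G) (- H) (1%:M - H *m G).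
have -> : \det D = \det Z.
  have -> : Z = block_mx D 0 (- H) 1%:M *m block_mx 1%:M G 0 1%:M.
    by rewrite mulmx_block ?mulmx1 ?mulmx0 ?mul1mx !addr0 mulNmx addrC.
  by rewrite det_mulmx det_lblock det_ublock !det1 !mulr1.
(* the row of the unit vector that borders A *)
pose i0 : 'I_((n + 1) + e) := lshift e (rshift n ord0).
pose S := [set j : 'I_((n + 1) + e) | (n + 1 <= j)%N]%SET.
pose F (j : 'I_((n + 1) + e)) : dual M :=
  match fintype.split j with inl _ => 0 | inr l => b l end.
pose X (i : 'I_((n + 1) + e)) : M := match fintype.split i with
  | inl i => match fintype.split i with inl k => x k | inr _ => 0 end
  | inr j => z j end.
case: (posnP e) => [e0|e_gt0].
  apply: (@minors_laplace0 _ _ _ Z (@finset.set0 _) _ F X) => [i j|]; first by rewrite inE.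
  by rewrite e0.
apply: (@minors_laplace_row _ Z i0 S _ F X) => [i j ii0|].
  rewrite inE /F /X.
  case: (fintype.splitP j) => [l Dj|l Dj _]; first by rewrite Dj leqNgt ltn_ord.
  have -> : j = rshift (n + 1) l by apply: val_inj.
  case: (fintype.splitP i) => [k Di|k Di]; last first.
    by have -> : i = rshift (n + 1) k by [apply: val_inj]; rewrite block_mxEdr zP.
  have Di' : i = lshift e k by apply: val_inj.
  rewrite Di' block_mxEur mul_col_mx; case: (fintype.splitP k) => [k' Dk|k' Dk].
    by have -> : k = lshift 1 k' by [apply: val_inj]; rewrite col_mxEu xP.
  case/eqP: ii0; rewrite Di' /i0; congr lshift; apply: val_inj.
  by rewrite /= Dk ord1.
have -> : S = [set rshift (n + 1) l | l : 'I_e]%SET.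
  apply/setP => j; rewrite !inE; apply/idP/imsetP => [nj|[l _ ->]]; last exact: leq_addr.
  case: (fintype.splitP j) => [l Dj|l Dj]; first by rewrite Dj leqNgt ltn_ord in nj.
  by exists l => //; exact: val_inj.
rewrite card_imset; last exact: rshift_inj.
by rewrite card_ord subn1 prednK.
Qed.

(** Renumbering the generators moves the selected columns to the front; a repeated
    column makes the determinant vanish. *)
Lemma fitt1_minor n p (g : 'I_n -> bidual_quot M) (A : 'M[R]_(p, n)) (f : 'I_p -> 'I_n) :
  n = (p + 1)%N -> generates g -> (forall i, \sum_l A i l *: g l = 0) ->
  \det (colsub f A) \in minors M (e - 1).
Proof.
move=> Dn; subst n => geng Ag.
have [/injectiveP f_inj|/injectivePn[i [j ij Dfij]]] := boolP (injectiveb f); last first.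
  rewrite -det_tr (determinant_alternate (i1 := i) (i2 := j)) ?ideal0 //.
  by move=> k; rewrite !mxE Dfij.
have [k0 k0f] : exists k0, k0 \notin codom f.
  apply: contrapT => nok0; have : (p + 1 <= size (codom f))%N.
    rewrite -[X in (X <= _)%N]card_ord; apply: leq_trans (card_size _).
    apply: subset_leq_card; apply/fintype.subsetP => k _.
    by apply: contrapT => /negP fk; apply: nok0; exists k.
  by rewrite size_codom card_ord addn1 ltnn.
pose h (i : 'I_(p + 1)) := match fintype.split i with inl j => f j | inr _ => k0 end.
have h_inj : injective h.
  have hl j : h (lshift 1 j) = f j by rewrite /h (unsplitK (inl _ j)).
  have hr j : h (rshift p j) = k0 by rewrite /h (unsplitK (inr _ j)).
  move=> i j; rewrite -[i]splitK -[j]splitK.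
  case: (fintype.split i) (fintype.split j) => [i'|i'] [j'|j'] /=; rewrite ?hl ?hr.
  - by move/f_inj->.
  - by move=> Dk0; rewrite -Dk0 codom_f in k0f.
  - by move=> Dk0; rewrite Dk0 codom_f in k0f.
  - by rewrite (ord1 i') (ord1 j').
have h_bij := injF_bij h_inj.
have -> : colsub f A = lsubmx (colsub h A).
  by apply/matrixP => i j; rewrite !mxE /h (unsplitK (inl _ j)).
apply: (@fitt1_minor_last _ (g \o h)) => [u|i].
  have [a ->] := geng u; exists (a \o h).
  by rewrite (reindex h); last exact: onW_bij.
rewrite -[RHS](Ag i) [RHS](reindex h); last exact: onW_bij.
by apply: eq_bigr => j _; rewrite mxE.
Qed.

Lemma fitt1_sub_minors : {subset fitt1_bidual M <= minors M (e - 1)}.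
Proof.
move=> d /asboolP[n [g [geng]]]; apply: span_sub => {}d [A [f [Ag ->]]].
have [n0|n_gt0] := posnP n; last exact: (fitt1_minor f (esym (subnK n_gt0)) geng Ag).
subst n; have [G [H [_ [z zP]]]] := bidual_generators geng.
have -> : \det (colsub f A) = \det (1%:M - H *m G).
  rewrite (flatmx0 G) mulmx0 subr0 det1; exact: det_mx00.
apply: (@minors_laplace0 _ _ _ _ [set: 'I_e]%SET _ b z) => [i j _|]; first exact: zP.
by rewrite cardsT card_ord leq_subr.
Qed.

End Fitting.

(** * The fraction module and the rank *)

Section Frac.
Variables (R : idomainType).
Local Notation K := {fraction R}.
Local Notation "x %:F" := (@FracField.tofrac R x).
Variable M : lmodType R.
Local Notation pi := (\pi_(frac_mod M)).

Lemma tofrac_inj : injective (@FracField.tofrac R).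
Proof.
move=> x y /eqP; rewrite -subr_eq0 -tofracB tofrac_eq0 subr_eq0.
by move/eqP.
Qed.

Lemma to_frac_modD x y : to_frac_mod (x + y) = to_frac_mod x + to_frac_mod y :> frac_mod M.
Proof.
rewrite -[RHS]/(frac_add _ _) pi_frac_add; apply/pi_fracP; exists 1.
by rewrite oner_neq0 /=; split=> //; rewrite !mul1r !scale1r.
Qed.

Lemma to_frac_modZ a x : to_frac_mod (a *: x) = a%:F *: to_frac_mod x :> frac_mod M.
Proof.
have -> : a%:F = \pi_K (Ratio a 1) by unlock FracField.tofrac.
rewrite -[RHS]/(frac_scale _ _) pi_frac_scale; apply/pi_fracP; exists 1.
rewrite oner_neq0 /=; split=> //.
by rewrite !numden_Ratio ?oner_neq0 // !mul1r scale1r.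
Qed.

Lemma to_frac_mod0 : to_frac_mod (0 : M) = 0.
Proof. by rewrite -(scale0r 0) to_frac_modZ tofrac0 scale0r. Qed.

Lemma to_frac_mod_sum n (a : 'I_n -> R) (q : 'I_n -> M) :
  to_frac_mod (\sum_i a i *: q i) = \sum_i (a i)%:F *: to_frac_mod (q i).
Proof.
rewrite (big_morph _ to_frac_modD to_frac_mod0).
by apply: eq_bigr => i _; rewrite to_frac_modZ.
Qed.

Lemma to_frac_mod_inj : torsion_free M -> injective (@to_frac_mod R M).
Proof.
move=> tfM x y /pi_fracP[t [t0]] /=; rewrite !mulr1 => /eqP.
rewrite -subr_eq0 -scalerBr => /eqP/tfM[Dt|/eqP]; first by rewrite Dt eqxx in t0.
by rewrite subr_eq0 => /eqP.
Qed.

Lemma frac_modP (z : frac_mod M) :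
  exists d q, d != 0 /\ d%:F *: z = to_frac_mod q.
Proof.
elim/frac_modW: z => -[q [d d0]]; exists d, q; split=> //.
have -> : d%:F = \pi_K (Ratio d 1) by unlock FracField.tofrac.
rewrite -[LHS]/(frac_scale _ _) pi_frac_scale; apply/pi_fracP; exists 1.
rewrite oner_neq0 /=; split=> //.
by rewrite !numden_Ratio ?oner_neq0 // !mul1r !scale1r.
Qed.

Lemma fraction_clear (k : K) : exists d n, d != 0 /\ d%:F * k = n%:F.
Proof.
elim/fracW: k => r; exists \d_r, \n_r; split; first exact: denom_ratioP.
have tofracE x : x%:F = \pi_K (Ratio x 1) by unlock FracField.tofrac.
rewrite !tofracE -[LHS]FracField.pi_mul; apply/eqP; rewrite piE FracField.equivfE.
by rewrite /FracField.mulf !numden_Ratio ?mulf_neq0 ?oner_neq0 ?denom_ratioP //; apply/eqP; ring.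
Qed.

Lemma clear_denoms (T : finType) (k : T -> K) :
  exists2 s : R, s != 0 & forall i, exists a, s%:F * k i = a%:F.
Proof.
have /choice[d dP] i := fraction_clear (k i).
exists (\prod_i d i) => [|i]; first by apply/prodf_neq0 => i _; case: (dP i) => n [].
have [n [_ Dn]] := dP i; exists ((\prod_(j | j != i) d j) * n).
by rewrite (bigD1 i) //= !tofracM -Dn mulrA [_ * (d i)%:F]mulrC.
Qed.

End Frac.

Lemma kermx_rank_le (F : fieldType) p k l (Z : 'M[F]_(p, k)) (W : 'M[F]_(p, l)) :
  (forall u : 'rV[F]_p, u *m Z = 0 -> u *m W = 0) -> (\rank W <= \rank Z)%N.
Proof.
move=> ZW; have : (kermx Z <= kermx W)%MS.
  by apply/rV_subP => u /sub_kermxP/ZW uW; exact/sub_kermxP.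
by move/mxrankS; rewrite !mxrank_ker leq_sub2lE ?rank_leq_row.
Qed.

Lemma row_full_submx (F : fieldType) p k (Z : 'M[F]_(p, k)) :
  (forall w : 'rV[F]_k, exists u, w = u *m Z) -> \rank Z = k.
Proof.
move=> Zsurj; apply/eqP; rewrite -[_ == _]/(row_full Z) -sub1mx; apply/rV_subP => w _.
by have [u ->] := Zsurj w; exact: submxMl.
Qed.

Lemma col_free_rank (F : fieldType) p k (Z : 'M[F]_(p, k)) :
  (forall u : 'rV[F]_k, u *m Z^T = 0 -> u = 0) -> \rank Z = k.
Proof.
move=> Zinj; rewrite -mxrank_tr; apply/eqP; rewrite -[_ == _]/(row_free Z^T) -kermx_eq0.
by apply/rowV0P => u /sub_kermxP/Zinj.
Qed.

Section Rank.
Variables (R : idomainType) (M : lmodType R).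
Local Notation K := {fraction R}.
Local Notation "x %:F" := (@FracField.tofrac R x).

(** In other words, M embeds in its bidual. *)
Definition torsionless := forall x : M, (forall f : dual M, dual_fun f x = 0) -> x = 0.

Lemma torsionless_torsion_free : torsionless -> torsion_free M.
Proof.
move=> tlM r x rx0; have [->|r0] := eqVneq r 0; [by left|right].
apply: tlM => f; have /eqP : r * dual_fun f x = 0.
  by rewrite -[LHS]/(r *: dual_fun f x) -linearZ rx0 linear0.
by rewrite mulf_eq0 (negPf r0) => /eqP.
Qed.

(** A coordinate function on the fraction module, multiplied by a common denominator
    of its values on the generators of M, is a functional on M. *)
Lemma has_rank_torsionless e :
  finitely_generated M -> torsion_free M -> has_rank M e -> torsionless.
Proof.
move=> [p [q genq]] tfM [Phi Phi_bij] x fx0.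
apply: (to_frac_mod_inj tfM); rewrite to_frac_mod0; apply: (bij_inj Phi_bij).
rewrite linear0; apply/matrixP => i0 k; rewrite [i0]ord1 mxE {i0}.
have [s s0 sP] := clear_denoms (fun i => Phi (to_frac_mod (q i)) 0 k).
have [a aP] := choice sP.
have /choice[h hP] (y : M) : exists r, s%:F * Phi (to_frac_mod y) 0 k = r%:F.
  have [c ->] := genq y; exists (\sum_i c i * a i).
  rewrite to_frac_mod_sum linear_sum summxE mulr_sumr rmorph_sum.
  by apply: eq_bigr => i _; rewrite linearZ mxE mulrCA aP -tofracM.
have h_lin : linear (h : M -> R^o).
  move=> c u v; suff : h (c *: u + v) = c * h u + h v by [].
  apply: tofrac_inj; rewrite -hP to_frac_modD to_frac_modZ linearP !mxE.
  by rewrite mulrDr mulrCA !hP tofracD tofracM.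
have hx0 : h x = 0 := fx0 (mk_dual h_lin).
have /eqP := hP x; rewrite hx0 tofrac0 mulf_eq0 tofrac_eq0 (negPf s0) /=.
by move/eqP.
Qed.

(** Let X hold the coordinates of the generators of M in K^e, and Y their values
    under b. The left kernel of both is given by the relations between the
    generators, so that X and Y have the same rank. It is e for X because M spans
    the fraction module, and n for Y because b is free. *)
Theorem rank_dual_basis e n (b : 'I_n -> dual M) :
  finitely_generated M -> torsion_free M -> has_rank M e -> is_basis b -> n = e.
Proof.
move=> fgM tfM rkM [genb freeb]; have tlM := has_rank_torsionless fgM tfM rkM.
case: fgM => p [q genq]; case: rkM => Phi Phi_bij.
pose X : 'M[K]_(p, e) := \matrix_(i, k) Phi (to_frac_mod (q i)) 0 k.
pose Y : 'M[K]_(p, n) := \matrix_(i, j) (dual_fun (b j) (q i))%:F.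
have rowX (a : 'I_p -> R) :
    \row_i (a i)%:F *m X = Phi (to_frac_mod (\sum_i a i *: q i)).
  rewrite to_frac_mod_sum linear_sum; apply/rowP => k; rewrite mxE summxE.
  by apply: eq_bigr => i _; rewrite linearZ !mxE.
have kerX (a : 'I_p -> R) : \row_i (a i)%:F *m X = 0 <-> \sum_i a i *: q i = 0.
  rewrite rowX; split=> [|->]; last by rewrite to_frac_mod0 linear0.
  by rewrite -(linear0 Phi) -to_frac_mod0 => /(bij_inj Phi_bij)/(to_frac_mod_inj tfM).
have kerY (a : 'I_p -> R) : \row_i (a i)%:F *m Y = 0 <-> \sum_i a i *: q i = 0.
  have YE j : (\row_i (a i)%:F *m Y) 0 j = (dual_fun (b j) (\sum_i a i *: q i))%:F.
    rewrite linear_sum mxE rmorph_sum; apply: eq_bigr => i _.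
    by rewrite linearZ !mxE -tofracM.
  split=> [aY|aq0]; last by apply/rowP => j; rewrite YE aq0 linear0 tofrac0 mxE.
  apply: tlM => f; have [c ->] := genb f; rewrite dual_fun_sum big1 // => j _.
  suff -> : dual_fun (b j) (\sum_i a i *: q i) = 0 by rewrite mulr0.
  by apply: (@tofrac_inj R); rewrite -YE aY mxE tofrac0.
have kerE (u : 'rV[K]_p) : (u *m X = 0) <-> (u *m Y = 0).
  have [s s0 sP] := clear_denoms (fun i => u 0 i); have [a aP] := choice sP.
  have su : s%:F *: u = \row_i (a i)%:F by apply/rowP => i; rewrite !mxE aP.
  have sF0 : s%:F != 0 by rewrite tofrac_eq0.
  have scale0 k (Z : 'M[K]_(p, k)) : u *m Z = 0 <-> \row_i (a i)%:F *m Z = 0.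
    rewrite -su -scalemxAl; split=> [->|/eqP]; first exact: scaler0.
    by rewrite scaler_eq0 (negPf sF0) => /eqP.
  by rewrite !scale0 kerX kerY.
have rkE : \rank X = \rank Y.
  by apply/eqP; rewrite eqn_leq !kermx_rank_le // => u /kerE.
have <- : \rank X = e.
  apply: row_full_submx => w.
  have [z Dw] : exists z, w = Phi z.
    by have [g _ gK] := Phi_bij; exists (g w); rewrite gK.
  have [d [y [d0 Dy]]] := frac_modP z; have [a Da] := genq y.
  have dF0 : d%:F != 0 by rewrite tofrac_eq0.
  exists (d%:F^-1 *: \row_i (a i)%:F); rewrite -scalemxAl.
  apply: (scalerI dF0); rewrite scalerA divff // scale1r Dw -linearZ Dy Da.
  by rewrite rowX.
rewrite rkE; apply/esym/col_free_rank => u uY.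
have [s s0 sP] := clear_denoms (fun j => u 0 j); have [c cP] := choice sP.
have c0 : forall j, c j = 0.
  apply: freeb; apply: dual_ext => x; rewrite dual_fun0.
  have [a ->] := genq x; rewrite linear_sum big1 // => i _; rewrite linearZ /= dual_fun_sum.
  suff -> : \sum_j c j * dual_fun (b j) (q i) = 0 by rewrite scaler0.
  apply: (@tofrac_inj R); rewrite tofrac0 rmorph_sum.
  have /rowP/(_ i) := uY; rewrite !mxE => /(congr1 ( *%R s%:F)).
  rewrite mulr0 mulr_sumr => u0; rewrite -[RHS]u0; apply: eq_bigr => j _.
  by rewrite !mxE mulrA cP -tofracM.
apply/rowP => j; have sF0 : s%:F != 0 by rewrite tofrac_eq0.
by apply: (mulfI sF0); rewrite cP c0 tofrac0 mxE mulr0.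
Qed.

End Rank.

(** * Linear bijections *)

Definition mk_linear (R : comNzRingType) (M N : lmodType R) (f : M -> N)
    (f_lin : linear f) : {linear M -> N} :=
  HB.pack_for {linear M -> N} f (GRing.isLinear.Build R M N *:%R f f_lin).

Lemma module_iso_can (R : comNzRingType) (M N : lmodType R) :
  module_iso M N ->
  exists (f : {linear M -> N}) (g : {linear N -> M}), cancel f g /\ cancel g f.
Proof.
case=> f [g fK gK]; have g_lin : linear g.
  by move=> a x y; apply: (can_inj fK); rewrite gK linearP !gK.
by exists f, (mk_linear g_lin).
Qed.

Lemma inj_surj_bijective (A B : Type) (f : A -> B) :
  injective f -> (forall y, exists x, f x = y) -> bijective f.
Proof.
move=> f_inj /choice[g gK]; exists g => // x.
by apply: f_inj; rewrite gK.
Qed.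

Lemma module_iso_bijective (R : comNzRingType) (M N : lmodType R) (f : M -> N) :
  linear f -> injective f -> (forall y, exists x, f x = y) -> module_iso M N.
Proof.
move=> f_lin f_inj f_surj.
exists (mk_linear f_lin).
exact: inj_surj_bijective.
Qed.

(** * Valuations *)

Section Valuation.
Variables (R : idomainType).
Local Notation K := {fraction R}.
Local Notation "x %:F" := (@FracField.tofrac R x).
Variables (V : set K) (v : K -> int).
Hypotheses (RV : forall r, V r%:F) (v_val : discrete_valuation v).
Hypothesis VE : forall k, V k <-> k = 0 \/ 0 <= v k.

Lemma valM x y : x != 0 -> y != 0 -> v (x * y) = v x + v y.
Proof. by case: v_val => _ + _; apply. Qed.

Lemma val1 : v 1 = 0.
Proof.
have := valM (oner_neq0 K) (oner_neq0 K); rewrite mulr1 => /eqP.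
by rewrite -subr_eq0 opprD addrA subrr add0r oppr_eq0 => /eqP.
Qed.

Lemma valX x n : x != 0 -> v (x ^+ n) = v x *+ n.
Proof.
move=> x0; elim: n => [|n IH]; first by rewrite mulr0n val1.
by rewrite exprS valM ?expf_neq0 // IH mulrS.
Qed.

Lemma val_ge0 a : a != 0 -> 0 <= v a%:F.
Proof. by move=> a0; have [/eqP|//] := (VE _).1 (RV a); rewrite tofrac_eq0 (negPf a0). Qed.

(** The proofs are arguments so that the structure of ideal can be inferred. *)
Definition val_ideal (_ : forall r, V r%:F) (_ : discrete_valuation v)
    (_ : forall k, V k <-> k = 0 \/ 0 <= v k) (k : int) : {pred R^o} :=
  [pred a : R^o | (a == 0) || (k <= v (a : R)%:F)].
Local Notation I := (val_ideal RV v_val VE).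

Lemma mem_val_ideal k (a : R) : (a \in I k) = (a == 0) || (k <= v a%:F).
Proof. by []. Qed.

Lemma val_ideal_closed k : submod_closed (I k).
Proof.
split=> [|c a b]; first by rewrite inE eqxx.
move=> Ia Ib; have {Ia} Ica : c * a \in I k.
  rewrite !mem_val_ideal in Ia *; case/orP: Ia => [/eqP->|ka]; first by rewrite mulr0 eqxx.
  have [->|a0] := eqVneq a 0; first by rewrite mulr0 eqxx.
  have [->|c0] := eqVneq c 0; first by rewrite mul0r eqxx.
  by rewrite tofracM valM ?tofrac_eq0 // ler_wpDl ?val_ge0 // orbT.
rewrite -[_ *: _]/(c * a); move: (c * a) Ica => {c}a Ia.
rewrite !mem_val_ideal in Ia Ib *.
have [a0|a0] := eqVneq a 0; first by rewrite a0 add0r.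
have [b0|b0] := eqVneq b 0; first by rewrite b0 addr0.
have [//|ab0] := eqVneq (a + b) 0; rewrite (negPf a0) (negPf b0) /= in Ia Ib *.
have [_ _ /(_ a%:F b%:F)] := v_val; rewrite -tofracD !tofrac_eq0 => /(_ a0 b0 ab0).
by case; apply: le_trans.
Qed.
HB.instance Definition _ k :=
  GRing.isSubmodClosed.Build R R^o (I k) (val_ideal_closed k).

Lemma val_idealM k l a b : a \in I k -> b \in I l -> a * b \in I (k + l).
Proof.
rewrite !mem_val_ideal => /orP[/eqP->|ka]; first by rewrite mul0r eqxx.
case/orP => [/eqP->|lb]; first by rewrite mulr0 eqxx.
have [->|a0] := eqVneq a 0; first by rewrite mul0r eqxx.
have [->|b0] := eqVneq b 0; first by rewrite mulr0 eqxx.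
by rewrite tofracM valM ?tofrac_eq0 // lerD // orbT.
Qed.

Lemma ideal_exp_val (J : {pred R}) k n :
  {subset J <= I k} -> {subset ideal_exp J n <= I (k *+ n)}.
Proof.
move=> Jk; elim: n => [|n IH].
  move=> a _; rewrite mem_val_ideal mulr0n.
  by have [//|a0] := eqVneq a 0; rewrite val_ge0.
rewrite mulrS -add1n; apply: ideal_expD_sub => a b Ja Jb.
apply: val_idealM; last exact: IH.
by apply: (ideal_exp1_sub (I := I k)); exact: (ideal_exp_mono Jk).
Qed.

Lemma val_div (k : int) a b : b != 0 -> v b%:F <= k -> a \in I k -> V (a%:F / b%:F).
Proof.
move=> b0 bk; rewrite mem_val_ideal => /orP[/eqP->|ka].
  by apply/VE; left; rewrite tofrac0 mul0r.
have [->|a0] := eqVneq a 0; first by apply/VE; left; rewrite tofrac0 mul0r.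
apply/VE; right; have ab0 : a%:F / b%:F != 0 by rewrite mulf_neq0 ?invr_eq0 ?tofrac_eq0.
rewrite -(lerD2r (v b%:F)) -valM ?tofrac_eq0 // divfK ?tofrac_eq0 // add0r.
exact: le_trans ka.
Qed.

End Valuation.

(** * Modules whose maximal minors reduce a power of the maximal ideal *)

(** When the functionals on M have their values in m, this says that [minors M s]
    is a reduction of m^s. *)
Definition minors_reduction (R : idomainType) (m : submodClosed R^o) (M : lmodType R) s :=
  exists K, {subset ideal_exp m (K + s) <= ideal_mul (minors M s) (ideal_exp m K)}.

Lemma prod_in_exp (R : comNzRingType) (J : {pred R}) (T : finType) (F : T -> R) :
  (forall i, F i \in J) -> \prod_i F i \in ideal_exp J #|T|.
Proof.
move=> FJ; rewrite -big_enum /= cardE; elim: (enum T) => [|i s IH] /=.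
  exact: ideal_exp0.
by rewrite big_cons ideal_expS.
Qed.

Lemma det_in_exp (R : comNzRingType) (J : {pred R}) n (B : 'M[R]_n) :
  (forall i j, B i j \in J) -> \det B \in ideal_exp J n.
Proof.
move=> BJ; apply: ideal_sum => p _; apply: idealMl.
by have := prod_in_exp (fun i => BJ i (p i)); rewrite card_ord.
Qed.

Section FullModule.
Variables (R : idomainType) (m : submodClosed R^o) (M : lmodType R) (e : nat).
Local Notation K := {fraction R}.
Local Notation "x %:F" := (@FracField.tofrac R x).
Variable b : 'I_e -> dual M.
Hypotheses (b_basis : is_basis b) (tlM : torsionless M).
Hypothesis val_m : forall (f : dual M) x, dual_fun f x \in m.
Hypothesis M_red : minors_reduction m M e.
Variables x y : R.
Hypotheses (xy : regular_pair m x y) (x0 : x != 0) (y0 : y != 0).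

Let coord_mx (c : 'I_e -> 'I_e) (q : 'I_e -> M) : 'M[R]_e :=
  \matrix_(i, j) dual_fun (b (c j)) (q i).

Lemma basis_ext u v : (forall k, dual_fun (b k) u = dual_fun (b k) v) -> u = v.
Proof.
move=> uv; apply/eqP; rewrite -subr_eq0; apply/eqP/tlM => f.
have [a ->] := b_basis.1 f; rewrite dual_fun_sum big1 // => k _.
by rewrite linearB /= uv subrr mulr0.
Qed.

(** The entries of the adjugate are in m^(e-1), which puts the coefficients u i in
    m^e. Over a valuation ring this makes them divisible by any determinant whose
    value is at most that of m^e. *)
Lemma cramer c q (w : 'I_e -> R) : \det (coord_mx c q) != 0 -> (forall k, w k \in m) ->
  exists u : 'I_e -> R, (forall i, u i \in ideal_exp m e) /\
    forall k, dual_fun (b k) (\sum_i u i *: q i) = \det (coord_mx c q) * w k.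
Proof.
move=> d0 wm; pose W : 'rV[R]_e := \row_j w (c j).
exists (fun i => (W *m \adj (coord_mx c q)) 0 i); split=> [i|].
  have e_gt0 : (0 < e)%N := leq_ltn_trans (leq0n i) (ltn_ord i).
  rewrite mxE; apply: ideal_sum => j _; rewrite !mxE.
  have := ideal_expS (wm (c j)) (_ : cofactor (coord_mx c q) i j \in ideal_exp m e.-1).
  rewrite prednK //; apply; apply: idealMl; apply: det_in_exp => k l.
  by rewrite !mxE.
have c_inj : injective c.
  apply/injectiveP/injectivePn => -[i [j ij Dc]]; case/eqP: d0.
  rewrite -det_tr (determinant_alternate (i1 := i) (i2 := j)) //.
  by move=> k; rewrite !mxE Dc.
have [c' c'K cK] := injF_bij c_inj.
move=> k; rewrite linear_sum -(cK k); set j := c' k.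
have <- : (W *m \adj (coord_mx c q) *m coord_mx c q) 0 j = \det (coord_mx c q) * w (c j).
  by rewrite -mulmxA mul_adj_mx mul_mx_scalar !mxE.
by rewrite mxE; apply: eq_bigr => i _; rewrite linearZ !mxE.
Qed.

Lemma basis_minor_neq0 : exists c q, \det (coord_mx c q) != 0.
Proof.
apply: contrapT => noX; have [n red] := M_red.
have min0 : {subset minors M e <= span [set 0 : R^o]}.
  apply: (minors_basis b_basis.1) => c q; have [->|/eqP X0] := eqVneq (\det (coord_mx c q)) 0.
    exact: ideal0.
  by case: noX; exists c, q; apply/eqP.
have mx : x \in m by case: xy.
have : x ^+ (n + e) \in (span [set 0 : R^o] : {pred R^o}).
  apply: ideal_mul_sub (red _ (ideal_expX _ mx)) => a d /min0 a0 _.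
  exact: idealMr.
by case/span1P=> a /eqP; rewrite mulr0 expf_eq0 (negPf x0) andbF.
Qed.

(** Let t be x or y, whichever has the smaller value. If all e-minors had values
    greater than e v(t), then by the reduction property all elements of m^(n+e)
    would have values greater than (n+e) v(t), but t ^+ (n + e) does not. *)
Lemma basis_minor_val (V : set K) (v : K -> int) (RV : forall r, V r%:F)
    (v_val : discrete_valuation v) (VE : forall k, V k <-> k = 0 \/ 0 <= v k) :
  exists c q k, [/\ \det (coord_mx c q) != 0, v (\det (coord_mx c q))%:F <= k &
    {subset ideal_exp m e <= val_ideal RV v_val VE k}].
Proof.
have [mx my mxy] := xy.
have [t [mt t0 xt yt]] : exists t,
    [/\ t \in m, t != 0, v t%:F <= v x%:F & v t%:F <= v y%:F].
  by case: (lerP (v x%:F) (v y%:F)) => vxy; [exists x | exists y]; split=> //; exact: ltW.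
have mI : {subset m <= val_ideal RV v_val VE (v t%:F)}.
  move=> a /mxy[c [d ->]].
  apply: (@idealD _ (val_ideal RV v_val VE _)); apply: (@idealMl _ (val_ideal RV v_val VE _)).
    by rewrite mem_val_ideal xt orbT.
  by rewrite mem_val_ideal yt orbT.
apply: contrapT => noX; have [n red] := M_red.
have minI : {subset minors M e <= val_ideal RV v_val VE (v t%:F *+ e + 1)}.
  apply: (@minors_basis _ _ _ _ _ (val_ideal RV v_val VE _) b_basis.1) => c q.
  suff : (\det (coord_mx c q) : R) \in val_ideal RV v_val VE (v t%:F *+ e + 1) by [].
  rewrite mem_val_ideal.
  have [//|d0] := eqVneq (\det (coord_mx c q)) 0.
  rewrite /= -ltzD1 ltrD2r ltNge; apply/negP => dk; case: noX.
  exists c, q, (v t%:F *+ e); split; [exact: d0|exact: dk|] => a ma.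
  exact: (@ideal_exp_val _ _ _ RV v_val VE m _ e mI a ma).
have : (t ^+ (n + e) : R) \in val_ideal RV v_val VE (v t%:F *+ e + 1 + v t%:F *+ n).
  apply: (@ideal_mul_sub _ _ _ (val_ideal RV v_val VE _)) (red _ (ideal_expX _ mt)).
  move=> a d /minI aI dI.
  by apply: val_idealM => //; exact: (@ideal_exp_val _ _ _ RV v_val VE m _ n mI d dI).
rewrite mem_val_ideal expf_eq0 (negPf t0) andbF tofracXn (valX v_val) ?tofrac_eq0 //.
rewrite mulrnDr; move: (v _ *+ n) (v _ *+ e) => /= i j; lia.
Qed.

Hypothesis icM : integrally_closed M.

(** Fix one nonzero determinant d. Cramer's rule writes w as p / d with p in M, which
    defines an element of the fraction module. For a given V, Cramer's rule with
    the determinant of [basis_minor_val] writes the same element as a combination of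
    elements of M with coefficients in V. So it is in the integral closure of
    M. *)
Lemma full_coords (w : 'I_e -> R) : (forall k, w k \in m) ->
  exists z, forall k, dual_fun (b k) z = w k.
Proof.
move=> wm; have tfM := torsionless_torsion_free tlM.
have [c [q [d0]]] : exists c q, \det (coord_mx c q) != 0 by exact: basis_minor_neq0.
set d := \det _ in d0 *; have [u [_]] := cramer d0 wm; set p := \sum_i _ => up.
pose z := d%:F^-1 *: to_frac_mod p.
have dF0 : d%:F != 0 by rewrite tofrac_eq0.
have : module_closure z.
  move=> V [RV [v v_val VE]].
  have [c' [q' [k [d'0 vd' mk]]]] := basis_minor_val RV v_val VE.
  have [u' [u'm u'p]] := cramer d'0 wm; set d' := \det _ in d'0 vd' u'p.
  have d'F0 : d'%:F != 0 by rewrite tofrac_eq0.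
  exists [seq ((u' i)%:F / d'%:F, q' i) | i <- enum 'I_e]; split.
    move=> _ /mapP[i _ ->] /=; exact: (val_div d'0 vd' (mk _ (u'm i))).
  apply: (scalerI dF0); apply: (scalerI d'F0); rewrite [d%:F *: z]scalerA divff // scale1r.
  rewrite -to_frac_modZ big_map big_enum /= [RHS]scalerA mulrC -scalerA.
  transitivity (to_frac_mod (d *: \sum_i u' i *: q' i)).
    congr to_frac_mod; apply: basis_ext => l; rewrite !linearZ /= u'p up.
    exact: mulrCA.
  rewrite to_frac_modZ to_frac_mod_sum; congr (_ *: _).
  rewrite scaler_sumr; apply: eq_bigr => i _.
  by rewrite scalerA mulrC divfK.
rewrite icM => -[s _ Ds]; exists s => l.
have Dp : p = d *: s.
  by apply: (to_frac_mod_inj tfM); rewrite to_frac_modZ Ds scalerA divff // scale1r.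
by apply: (mulfI d0); rewrite -up Dp linearZ.
Qed.

Definition coords (s : M) : {ffun 'I_e -> submod_type m} :=
  [ffun k => exist _ (dual_fun (b k) s) (val_m (b k) s)].

Lemma coords_linear : linear coords.
Proof.
move=> a u v; apply/ffunP => k; rewrite !ffunE; apply: val_inj => /=.
by rewrite linearP.
Qed.

Theorem full_module_iso : module_iso M {ffun 'I_e -> submod_type m}.
Proof.
apply: (module_iso_bijective coords_linear) => [u v /ffunP uv|w].
  by apply: basis_ext => k; have := uv k; rewrite !ffunE => -[].
have [|s Ds] := full_coords (w := fun k => \val (w k)); first by move=> k; exact: valP.
by exists s; apply/ffunP => k; apply: val_inj; rewrite ffunE /= Ds.
Qed.

End FullModule.

(** * Nakayama's lemma and reductions *)

Section Nakayama.
Variables (R : idomainType) (m : submodClosed R^o).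
Hypotheses (noeR : noetherian R) (locR : is_local m).
Implicit Types (J : submodClosed R^o).

Lemma ideal_mul_span_cons g (s : seq R) a :
  a \in ideal_mul m (span [set z : R^o | z \in g :: s]) ->
  exists b r, [/\ b \in m, r \in ideal_mul m (span [set z : R^o | z \in s]) & a = b * g + r].
Proof.
pose N : submodClosed R^o := ideal_mul m (span [set z : R^o | z \in s]).
pose G : submodClosed R^o := ideal_mul (span [set g : R^o]) m.
suff sub : {subset ideal_mul m (span [set z : R^o | z \in g :: s]) <= ideal_add G N}.
  move=> /sub aGN; have [c [r [Gc Nr Da]]] := ideal_addP aGN.
  have [b mb Dc] := ideal_mul1P Gc; exists b, r; split=> //.
  by rewrite Da Dc mulrC.
apply: ideal_mul_sub => b c mb.
suff sub : {subset span [set z : R^o | z \in g :: s] <= colon (ideal_add G N) b}.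
  exact: sub.
apply: span_sub => z /=; rewrite inE colonE => /predU1P[->|zs].
  by rewrite mulrC; apply/mem_ideal_addl/mem_ideal_mul => //; exact: span_gen.
by apply/mem_ideal_addr/mem_ideal_mul => //; exact: span_gen.
Qed.

(** Elimination of one generator at a time: 1 - b is a unit when b is in m, so that g
    is a combination of the other generators with coefficients in m modulo J, and
    can be substituted in the other relations. *)
Lemma nakayama_seq (s : seq R) J :
  (forall g, g \in s -> g \in ideal_add J (ideal_mul m (span [set z : R^o | z \in s]))) ->
  forall g, g \in s -> g \in J.
Proof.
elim: s J => // g s IH J sJ.
pose N : submodClosed R^o := ideal_mul m (span [set z : R^o | z \in s]).
have JN h : h \in g :: s -> exists j b r, [/\ j \in J, b \in m, r \in N & h = j + b * g + r].
  move=> hs; have [j [c [Jj Nc Dh]]] := ideal_addP (sJ _ hs).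
  have [b [r [mb Nr Dc]]] := ideal_mul_span_cons Nc.
  by exists j, b, r; rewrite Dh Dc addrA.
have gJN : g \in ideal_add J N.
  have [j [b [r [Jj mb Nr Dg]]]] := JN g (mem_head _ _).
  have bU := subr1_unit noeR locR mb.
  rewrite -(mulKr bU g); apply: idealMl.
  have -> : (1 - b) * g = j + r by rewrite mulrBl mul1r {1}Dg addrAC addrK.
  by apply: idealD; [exact: mem_ideal_addl|exact: mem_ideal_addr].
have sJ' h : h \in s -> h \in J.
  apply: IH => {}h hs; have [|j [b [r [Jj mb Nr ->]]]] := JN h.
    by rewrite inE hs orbT.
  apply: idealD; last exact: mem_ideal_addr.
  by apply: idealD; [exact: mem_ideal_addl|exact: idealMl].
have NJ : {subset N <= J}.
  apply: ideal_mul_sub => b c _ sc; apply: idealMl.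
  by apply: span_sub sc => z; exact: sJ'.
move=> h; rewrite inE => /predU1P[->|/sJ'//].
exact: (ideal_add_sub _ NJ gJN).
Qed.

Lemma nakayama_exp J n :
  {subset ideal_exp m n <= ideal_add J (ideal_exp m n.+1)} -> {subset ideal_exp m n <= J}.
Proof.
move=> nJ; have [k [g Dg]] := noeR (ideal_exp m n).
have gm i : g i \in ideal_exp m n by rewrite Dg; apply: span_gen; exists i.
have sub : {subset ideal_exp m n <= span [set z : R^o | z \in codom g]}.
  move=> a; rewrite Dg; apply: span_sub => _ [i _ <-].
  by apply: span_gen; rewrite /= codom_f.
have gJ : forall z, z \in codom g -> z \in J.
  apply: nakayama_seq => _ /codomP[i ->]; apply: ideal_add_sub (nJ _ (gm i)) => a.
    exact: mem_ideal_addl.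
  rewrite -add1n => ma; apply: mem_ideal_addr; move: a ma.
  apply: ideal_expD_sub => a b /ideal_exp1_sub ma mb.
  exact: mem_ideal_mul ma (sub _ mb).
move=> a; rewrite Dg; apply: span_sub => _ [i _ <-].
by apply: gJ; exact: codom_f.
Qed.

End Nakayama.

Section IntegralReduction.
Variables (R : idomainType) (m : submodClosed R^o).

Lemma ideal_expM (J : {pred R}) s i :
  {subset ideal_exp (ideal_exp J s) i <= ideal_exp J (s * i)}.
Proof.
elim: i => [|i IH]; first by move=> a _; rewrite muln0; exact: ideal_exp0.
rewrite -add1n; apply: ideal_expD_sub => a b /ideal_exp1_sub Ja /IH Jb.
by rewrite mulnDr muln1; exact: ideal_expD.
Qed.

(** In an equation of integral dependence the coefficient c i is in I^(i+1), hence in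
    T m^(s i). So the equation puts z ^+ n.+1 in T m^(s n). *)
Lemma integral_power (I : {pred R}) (T : submodClosed R^o) s z :
  {subset I <= T} -> {subset T <= ideal_exp m s} -> z \in ideal_exp m s ->
  z \in integral_closure I ->
  exists n, forall k, (n <= k)%N -> z ^+ k.+1 \in ideal_mul T (ideal_exp m (s * k)).
Proof.
move=> IT Tm mz /asboolP[n [c [cI zc]]]; exists n => k nk.
have zX j : z ^+ j \in ideal_exp m (s * j) by apply/ideal_expM/ideal_expX.
have IexpT i : {subset ideal_exp I i.+1 <= ideal_mul T (ideal_exp m (s * i))}.
  rewrite -add1n; apply: ideal_expD_sub => a b /(ideal_exp_mono IT)/ideal_exp1_sub Ta Ib.
  apply: mem_ideal_mul Ta _; apply: ideal_expM; apply: (ideal_exp_mono _ Ib).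
  by move=> d /IT/Tm.
suff zn : z ^+ n.+1 \in ideal_mul T (ideal_exp m (s * n)).
  rewrite -(subnKC nk) mulnDr -addSn exprD.
  exact: (ideal_mul_expD zn (zX _)).
have -> : z ^+ n.+1 = - \sum_(i < n.+1) c i * z ^+ (n - i).
  by apply/eqP; rewrite -addr_eq0 zc.
apply: idealN; apply: ideal_sum => i _.
have := ideal_mul_expD (IexpT _ _ (cI i)) (zX (n - i)%N).
by rewrite -mulnDr subnKC // -ltnS.
Qed.

(** It suffices to apply [integral_power] to x^s and y^s, because a monomial in x and
    y of large degree is divisible by a large power of one of them. *)
Lemma integral_reduction (I : {pred R}) (T : submodClosed R^o) s x y :
  regular_pair m x y -> {subset I <= T} -> {subset T <= ideal_exp m s} ->
  {subset ideal_exp m s <= integral_closure I} ->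
  exists k, {subset ideal_exp m (k + s) <= ideal_mul T (ideal_exp m k)}.
Proof.
move=> [mx my mxy] IT Tm mI.
have mxs := ideal_expX s mx; have mys := ideal_expX s my.
have [n nP] := integral_power IT Tm mxs (mI _ mxs).
have [n' nP'] := integral_power IT Tm mys (mI _ mys).
pose k := maxn n n'; have {}nP := nP k (leq_maxl _ _); have {}nP' := nP' k (leq_maxr _ _).
rewrite -!exprM in nP nP'; exists (s * k + s * k.+1)%N.
(* one of the exponents of a monomial of degree 2 s (k + 1) is at least s (k + 1) *)
apply: (ideal_exp_monomials mxy) => i j ij.
have {}ij : (i + j = s * k.+1 + s * k.+1)%N by rewrite ij addnAC [(s * k + s)%N]addnC -mulnS.
have half i' j' : (i' + j' = s * k.+1 + s * k.+1)%N -> (s * k.+1 <= i')%N ->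
    (s * k.+1 = (i' - s * k.+1) + j')%N.
  by move=> ij' ik; apply/eqP; rewrite -(eqn_add2l (s * k.+1)) addnA subnKC // ij'.
have [ik|/ltnW ik] := leqP (s * k.+1) i.
  have m' : x ^+ (i - s * k.+1) * y ^+ j \in ideal_exp m (s * k.+1).
    by rewrite {2}(half i j) //; apply: ideal_expD; exact: ideal_expX.
  by have := ideal_mul_expD nP m'; rewrite mulrA -exprD subnKC.
have jk : (s * k.+1 <= j)%N by rewrite -(leq_add2l i) ij leq_add2r.
have m' : x ^+ i * y ^+ (j - s * k.+1) \in ideal_exp m (s * k.+1).
  rewrite {2}(half j i) ?(addnC j) //.
  by rewrite addnC; apply: ideal_expD; exact: ideal_expX.
by have := ideal_mul_expD nP' m'; rewrite mulrCA -exprD subnKC.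
Qed.

End IntegralReduction.

(** * Retracts *)

Section Retract.
Variables (R : idomainType).
Local Notation K := {fraction R}.
Local Notation "x %:F" := (@FracField.tofrac R x).

Definition dual_comp (M N : lmodType R) (f : dual N) (p : {linear M -> N}) : dual M :=
  ((dual_fun f : {linear N -> R^o}) \o p : {linear M -> R^o}).

Lemma dual_compE (M N : lmodType R) (f : dual N) (p : {linear M -> N}) x :
  dual_fun (dual_comp f p) x = dual_fun f (p x).
Proof. by []. Qed.

Variables (M N : lmodType R) (i : {linear N -> M}) (p : {linear M -> N}).
Hypothesis iK : cancel i p.

Lemma retract_fg : finitely_generated M -> finitely_generated N.
Proof.
case=> n [q genq]; exists n, (p \o q) => x; have [a Da] := genq (i x); exists a.
by rewrite -[LHS]iK Da linear_sum; apply: eq_bigr => k _; rewrite linearZ.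
Qed.

Lemma retract_torsionless : torsionless M -> torsionless N.
Proof.
move=> tlM x fx0; rewrite -[x]iK (tlM (i x)) ?linear0 // => f.
exact: (fx0 (dual_comp f i)).
Qed.

Lemma retract_dual (m : submodClosed R^o) :
  (forall (f : dual M) x, dual_fun f x \in m) -> forall (f : dual N) x, dual_fun f x \in m.
Proof. by move=> Mm f x; have := Mm (dual_comp f p) (i x); rewrite dual_compE iK. Qed.

(** If q / d is in the closure of N, then i q / d is in that of M, hence is an element
    y of M, and p y is the element of N that is sought. *)
Lemma retract_integrally_closed :
  torsion_free M -> integrally_closed M -> integrally_closed N.
Proof.
move=> tfM icM; have tfN : torsion_free N.
  move=> r x rx0; have [|->|ix0] := tfM r (i x); [|by left|right].
    by rewrite -linearZ rx0 linear0.
  by rewrite -[x]iK ix0 linear0.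
apply/seteqP; split=> [z zV|_ [x _ <-] V [RV _]]; last first.
  exists [:: (1, x)]; split=> [k|]; last by rewrite big_seq1 scale1r.
  by rewrite inE => /eqP-> /=; rewrite -tofrac1; exact: RV.
have [d [q [d0 Dz]]] := frac_modP z; have dF0 : d%:F != 0 by rewrite tofrac_eq0.
have : module_closure (d%:F^-1 *: to_frac_mod (i q)).
  move=> V VV; have [s [sV zs]] := zV V VV.
  exists [seq (k.1, i k.2) | k <- s]; split=> [_ /mapP[k ks ->]|]; first exact: sV.
  rewrite big_map /= big_tnth; rewrite big_tnth in zs.
  set k := tnth (in_tuple s) in zs *.
  have [t t0 tP] := clear_denoms (fun j => (k j).1); have [a aP] := choice tP.
  have tF0 : t%:F != 0 by rewrite tofrac_eq0.
  have Dq : t *: q = d *: \sum_j a j *: (k j).2.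
    apply: (to_frac_mod_inj tfN); rewrite !to_frac_modZ -Dz zs to_frac_mod_sum.
    rewrite scalerA mulrC -scalerA; congr (_ *: _); rewrite scaler_sumr.
    by apply: eq_bigr => j _; rewrite scalerA aP.
  apply: (scalerI dF0); apply: (scalerI tF0); rewrite [d%:F *: _]scalerA divff // scale1r.
  rewrite -to_frac_modZ -linearZ Dq [i (_ *: _)]linearZ /= to_frac_modZ [RHS]scalerA mulrC -scalerA.
  congr (_ *: _); rewrite linear_sum scaler_sumr.
  rewrite (big_morph _ (@to_frac_modD R M) (@to_frac_mod0 R M)).
  by apply: eq_bigr => j _; rewrite [i (_ *: _)]linearZ /= to_frac_modZ scalerA aP.
rewrite icM => -[y _ Dy]; exists (p y) => //.
apply: (scalerI dF0); rewrite Dz -to_frac_modZ -linearZ; congr to_frac_mod.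
rewrite -[q]iK; congr (p _); apply: (to_frac_mod_inj tfM).
by rewrite to_frac_modZ Dy scalerA divff // scale1r.
Qed.

End Retract.

(** * Minors of a direct sum *)

(** Let A express g through f, and C express f through g. Then A C = 1, and over a
    nonzero commutative ring such an A has at least as many columns as rows. *)
Lemma basis_size_le (R : comNzRingType) (U : lmodType R) n k
    (f : 'I_n -> U) (g : 'I_k -> U) : generates f -> is_basis g -> (k <= n)%N.
Proof.
move=> genf [geng freeg]; have /choice[a Da] j := genf (g j).
have /choice[c Dc] i := geng (f i).
apply: (@mulmx1_min R _ _ (\matrix_(j, i) a j i) (\matrix_(i, j) c i j)).
apply/matrixP => j l; apply/eqP; rewrite -subr_eq0; apply/eqP; move: l.
apply: freeg; under eq_bigr do rewrite !mxE scalerBl.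
rewrite sumrB [X in _ - X](bigD1 j) //= eqxx mulr1n scale1r [X in _ - (_ + X)]big1; last first.
  by move=> i /negPf ij; rewrite eq_sym ij scale0r.
apply/eqP; rewrite addr0 subr_eq0 [g j]Da; apply/eqP.
under eq_bigr do rewrite scaler_suml.
rewrite exchange_big; apply: eq_bigr => i _.
rewrite Dc scaler_sumr; apply: eq_bigr => l _.
by rewrite !mxE scalerA.
Qed.

Section DirectSum.
Variables (R : idomainType) (m : submodClosed R^o).
Variables (M N1 N2 : lmodType R).
Variables (i1 : {linear N1 -> M}) (p1 : {linear M -> N1}).
Variables (i2 : {linear N2 -> M}) (p2 : {linear M -> N2}).
Hypotheses (iK1 : cancel i1 p1) (iK2 : cancel i2 p2).
Hypotheses (p1i2 : forall x, p1 (i2 x) = 0) (p2i1 : forall x, p2 (i1 x) = 0).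
Hypothesis ipD : forall x, x = i1 (p1 x) + i2 (p2 x).
Variables (e1 e2 : nat) (b1 : 'I_e1 -> dual N1) (b2 : 'I_e2 -> dual N2).
Hypotheses (b1_basis : is_basis b1) (b2_basis : is_basis b2).

Definition sum_basis (j : 'I_(e1 + e2)) : dual M :=
  match fintype.split j with
  | inl l => dual_comp (b1 l) p1
  | inr l => dual_comp (b2 l) p2
  end.

Lemma sum_basisl l : sum_basis (lshift e2 l) = dual_comp (b1 l) p1.
Proof. by rewrite /sum_basis (unsplitK (inl _ l)). Qed.

Lemma sum_basisr l : sum_basis (rshift e1 l) = dual_comp (b2 l) p2.
Proof. by rewrite /sum_basis (unsplitK (inr _ l)). Qed.

Lemma sum_basis_basis : is_basis sum_basis.
Proof.
split=> [f|c c0].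
  have [a1 Da1] := b1_basis.1 (dual_comp f i1).
  have [a2 Da2] := b2_basis.1 (dual_comp f i2).
  exists (fun j => match fintype.split j with inl l => a1 l | inr l => a2 l end).
  apply: dual_ext => x; rewrite dual_fun_sum big_split_ord /= {1}[x]ipD linearD /=.
  congr (_ + _).
    rewrite -[LHS]/(dual_fun (dual_comp f i1) (p1 x)) Da1 dual_fun_sum.
    by apply: eq_bigr => l _; rewrite (unsplitK (inl _ l)) sum_basisl.
  rewrite -[LHS]/(dual_fun (dual_comp f i2) (p2 x)) Da2 dual_fun_sum.
  by apply: eq_bigr => l _; rewrite (unsplitK (inr _ l)) sum_basisr.
have c0x x : \sum_j c j * dual_fun (sum_basis j) x = 0.
  by rewrite -dual_fun_sum c0.
have cl l : c (lshift e2 l) = 0.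
  apply: (b1_basis.2 (fun l => c (lshift e2 l))); apply: dual_ext => x.
  rewrite dual_fun_sum dual_fun0 -[RHS](c0x (i1 x)) big_split_ord /=.
  rewrite [X in _ = _ + X]big1 ?addr0; last first.
    by move=> j _; rewrite sum_basisr dual_compE p2i1 linear0 mulr0.
  by apply: eq_bigr => j _; rewrite sum_basisl dual_compE iK1.
have cr l : c (rshift e1 l) = 0.
  apply: (b2_basis.2 (fun l => c (rshift e1 l))); apply: dual_ext => x.
  rewrite dual_fun_sum dual_fun0 -[RHS](c0x (i2 x)) big_split_ord /=.
  rewrite [X in _ = X + _]big1 ?add0r; last first.
    by move=> j _; rewrite sum_basisl dual_compE p1i2 linear0 mulr0.
  by apply: eq_bigr => j _; rewrite sum_basisr dual_compE iK2.
by move=> j; rewrite -(splitK j); case: (fintype.split j).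
Qed.

Lemma minors_sum_mul s1 s2 a b :
  a \in minors N1 s1 -> b \in minors N2 s2 -> a * b \in minors M (s1 + s2).
Proof.
apply: span_mul => _ _ [f1 [x1 ->]] [f2 [x2 ->]].
pose f j := match fintype.split j with
  | inl l => dual_comp (f1 l) p1 | inr l => dual_comp (f2 l) p2 end.
pose x j := match fintype.split j with inl l => i1 (x1 l) | inr l => i2 (x2 l) end.
have := @mem_minors R M (s1 + s2) f x.
set B := \matrix_(_, _) _; have -> : B = block_mx
    (\matrix_(i, j) dual_fun (f1 j) (x1 i)) 0 0 (\matrix_(i, j) dual_fun (f2 j) (x2 i)).
  apply/matrixP => i j; rewrite -(splitK i) -(splitK j).
  case: (fintype.split i) (fintype.split j) => [k|k] [l|l];
    rewrite ?(block_mxEul, block_mxEur, block_mxEdl, block_mxEdr) !mxE /f /x.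
  - by rewrite (unsplitK (inl _ k)) (unsplitK (inl _ l)) dual_compE iK1.
  - by rewrite (unsplitK (inl _ k)) (unsplitK (inr _ l)) dual_compE p2i1 linear0.
  - by rewrite (unsplitK (inr _ k)) (unsplitK (inl _ l)) dual_compE p1i2 linear0.
  - by rewrite (unsplitK (inr _ k)) (unsplitK (inr _ l)) dual_compE iK2.
by rewrite det_ublock.
Qed.

Hypothesis Mm : forall (f : dual M) x, dual_fun f x \in m.
Hypothesis N1_ord : {subset minors N1 e1 <= ideal_exp m e1.+1}.

(** A minor of size s = e1 + e2 - 1 omits one column of the block matrix. If it uses
    the e1 columns of N1, then it lies in the product of m^(e1+1) and m^(s-e1).
    Otherwise it uses s - e2 = e1 - 1 columns of N1 and the e2 columns of N2, and
    can be expanded along either block. *)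
Lemma minors_sum_sub s : s.+1 = (e1 + e2)%N ->
  {subset minors M s <= ideal_add (ideal_mul (minors N2 e2) (ideal_exp m (s - e2)))
                                  (ideal_exp m s.+1)} /\
  {subset minors M s <= ideal_add (ideal_mul (minors N1 (s - e2)) (ideal_exp m e2))
                                  (ideal_exp m s.+1)}.
Proof.
move=> De.
suff main (c : 'I_s -> 'I_(e1 + e2)) (x : 'I_s -> M) :
    let d := \det (\matrix_(i, j) dual_fun (sum_basis (c j)) (x i)) in
    d \in ideal_exp m s.+1 \/
    (d \in ideal_mul (minors N2 e2) (ideal_exp m (s - e2)) /\
     d \in ideal_mul (minors N1 (s - e2)) (ideal_exp m e2)).
  by split; apply: (@minors_basis _ _ _ _ _ (ideal_add _ _) sum_basis_basis.1) => c x;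
    have [dm|[d2 d1]] := main c x;
    do ?[exact: (mem_ideal_addr _ dm) | exact: (mem_ideal_addl _ d2)
        | exact: (mem_ideal_addl _ d1)].
move=> d.
have [/injectiveP c_inj|/injectivePn[i [j ij Dc]]] := boolP (injectiveb c); last first.
  left; rewrite /d -det_tr (determinant_alternate (i1 := i) (i2 := j)) ?ideal0 //.
  by move=> k; rewrite !mxE Dc.
pose S1 := [set j | (c j < e1)%N]%SET; pose S2 := (~: S1)%SET.
have S12 : (#|S1| + #|S2|)%N = s by rewrite cardsC card_ord.
have S2le : (#|S2| <= e2)%N.
  rewrite -(card_imset _ c_inj) -[leqRHS]card_ord -(card_imset _ (@rshift_inj e1 e2)).
  apply/subset_leq_card/fintype.subsetP => _ /imsetP[j Sj ->]; rewrite !inE in Sj.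
  case: (fintype.splitP (c j)) => l Dl; first by rewrite Dl ltn_ord in Sj.
  by apply/imsetP; exists l => //; exact: val_inj.
pose f1 j := match fintype.split (c j) with inl l => b1 l | inr _ => 0 end.
pose f2 j := match fintype.split (c j) with inl _ => 0 | inr l => b2 l end.
have lap1 t : (t <= #|S1|)%N -> d \in ideal_mul (minors N1 t) (ideal_exp m (s - t)).
  apply: (@minors_laplace _ _ _ _ S1 t m f1 (p1 \o x)) => i j; rewrite mxE //.
  rewrite inE /sum_basis /f1; by case: fintype.splitP.
have lap2 t : (t <= #|S2|)%N -> d \in ideal_mul (minors N2 t) (ideal_exp m (s - t)).
  apply: (@minors_laplace _ _ _ _ S2 t m f2 (p2 \o x)) => i j; rewrite mxE //.
  rewrite !inE /sum_basis /f2; by case: fintype.splitP.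
have [e1S|S1e] := leqP e1 #|S1|.
  left; apply: ideal_mul_sub (lap1 _ e1S) => a b /N1_ord ma mb.
  by have := ideal_expD ma mb; rewrite addSn subnKC // (leq_trans e1S) // -[leqRHS]S12 leq_addr.
have S1E : #|S1| = (s - e2)%N by lia.
have S2E : #|S2| = e2 by lia.
have e2s : (e2 <= s)%N by lia.
right; split; first by apply: lap2; rewrite S2E.
by have := lap1 (s - e2)%N; rewrite S1E leqnn subKn //; apply.
Qed.

Hypothesis R_reg : regular_local m 2.

(** By [minors_sum_sub] the s-minors of M lie, up to m^(s+1), in the two ideals built
    from N1 and N2, and Nakayama's lemma removes the error term. *)
Lemma minors_sum_reduce : (0 < e1)%N -> minors_reduction m M (e1 + e2 - 1) ->
  minors_reduction m N2 e2 /\ minors_reduction m N1 (e1 - 1).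
Proof.
have [noeR locR _ _] := R_reg => e1_gt0 [k red]; set s := (e1 + e2 - 1)%N in red.
have De : s.+1 = (e1 + e2)%N by rewrite /s subn1 prednK // addn_gt0 e1_gt0.
have Ds : (s - e2 = e1 - 1)%N by rewrite /s subnAC addnK.
have e2s : (e2 <= s)%N by rewrite -ltnS De -[X in (X < _)%N]add0n ltn_add2r.
have [sub2 sub1] := minors_sum_sub De.
have step (T : {pred R}) t :
    {subset minors M s <= ideal_add (ideal_mul T (ideal_exp m t)) (ideal_exp m s.+1)} ->
    {subset ideal_exp m (k + s) <= ideal_mul T (ideal_exp m (t + k))}.
  move=> subT; apply: (nakayama_exp noeR locR) => a /red; move: a.
  apply: ideal_mul_sub => a c /subT aT mc; have [a1 [a2 [Ta1 ma2 ->]]] := ideal_addP aT.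
  rewrite mulrDl; apply: idealD.
    by have := ideal_mul_expD Ta1 mc; exact: mem_ideal_addl.
  by have := ideal_expD ma2 mc; rewrite addSn addnC; exact: mem_ideal_addr.
split.
  exists (s - e2 + k)%N => a; rewrite addnAC subnK // addnC => /(step _ _ sub2).
  exact.
exists (e2 + k)%N => a; rewrite -Ds addnAC subnKC // addnC => /(step _ _ sub1).
exact.
Qed.

End DirectSum.

Lemma minors_in_exp (R : idomainType) (m : submodClosed R^o) (M : lmodType R) s :
  (forall (f : dual M) x, dual_fun f x \in m) -> {subset minors M s <= ideal_exp m s}.
Proof.
by move=> Mm; apply: minors_gen => f x; apply: det_in_exp => i j; rewrite mxE.
Qed.

(** * Splitting off copies of the maximal ideal *)

Section NoFreeSummand.
Variables (R : idomainType) (m : submodClosed R^o) (M : lmodType R).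
Hypotheses (noeR : noetherian R) (locR : is_local m).

(** A functional with a unit value at x splits M into R x and its kernel. *)
Lemma no_free_summand_dual : ~ has_free_summand M ->
  forall (f : dual M) x, dual_fun f x \in m.
Proof.
move=> noF f x; apply: contrapT => /negP/(notin_max_unit noeR locR); set c := dual_fun f x => cU.
apply: noF; exists 1%N; split=> //.
pose ker : submodClosed M := sub_ker (dual_fun f) (span setT).
exists (submod_type ker).
have fM z : dual_fun f (z - (dual_fun f z / c) *: x) = 0.
  by rewrite linearB linearZ /= -[(_ / _) *: _]/(dual_fun f z / c * c) divrK // subrr.
have kerP z : z - (dual_fun f z / c) *: x \in ker.
  by apply/andP; split; [exact: span_gen | exact/eqP/fM].
pose F z : ('rV[R]_1 * submod_type ker)%type :=
  (\row_(i < 1) (dual_fun f z : R), exist (fun u => u \in ker) _ (kerP z)).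
apply: (@module_iso_bijective _ _ _ F).
- move=> a u v; congr (_, _).
    by apply/rowP => i; rewrite !mxE linearP.
  apply: val_inj => /=; rewrite linearP /=.
  rewrite -[a *: dual_fun f u]/(a * dual_fun f u) mulrDl scalerDl -mulrA -scalerA scalerBr.
  by rewrite opprD addrACA.
- move=> u v [/rowP/(_ 0)]; rewrite !mxE => -> /(addIr _).
  exact.
- move=> [r [k kk]]; have [_ /eqP fk] := andP kk.
  exists (k + (r 0 0 / c) *: x).
  have fz : dual_fun f (k + (r 0 0 / c) *: x) = r 0 0.
    by rewrite linearD linearZ /= fk add0r -[(_ / _) *: _]/(r 0 0 / c * c) divrK.
  congr (_, _); first by apply/rowP => i; rewrite mxE ord1 fz.
  by apply: val_inj; rewrite /= fz addrK.
Qed.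

End NoFreeSummand.

Section Main.
Variables (R : idomainType) (m : submodClosed R^o).
Hypothesis R_reg : regular_local m 2.

(** These properties pass to direct summands; the last one holds when there is no free
    summand. *)
Definition summand_closed (M : lmodType R) : Prop :=
  [/\ finitely_generated M, torsionless M, integrally_closed M &
      forall (f : dual M) x, dual_fun f x \in m].

Lemma summand_closed_retract (M N : lmodType R) (i : {linear N -> M}) (p : {linear M -> N}) :
  cancel i p -> summand_closed M -> summand_closed N.
Proof.
move=> iK [fgM tlM icM Mm]; split.
- exact: retract_fg iK fgM.
- exact: retract_torsionless iK tlM.
- exact: retract_integrally_closed iK (torsionless_torsion_free tlM) icM.
- exact: (@retract_dual _ _ _ i p iK m Mm).
Qed.

Lemma basis_gt0 (M : lmodType R) e (b : 'I_e -> dual M) :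
  torsionless M -> ~ trivial_module M -> is_basis b -> (0 < e)%N.
Proof.
move=> tlM Mnt [genb _]; rewrite lt0n; apply/eqP => e0; apply: Mnt => x.
apply: tlM => f; have [a ->] := genb f; rewrite dual_fun_sum big1 // => i.
by have := ltn_ord i; rewrite [X in (_ < X)%N]e0.
Qed.

Lemma full_summand (M : lmodType R) e (b : 'I_e -> dual M) :
  summand_closed M -> is_basis b -> minors_reduction m M e ->
  module_iso M {ffun 'I_e -> submod_type m}.
Proof.
move=> [_ tlM icM Mm] b_basis red; have [x [y xy]] := exists_regular_pair R_reg.
have x0 := regular_pair_neq0 R_reg xy; have y0 := regular_pair_neq0 R_reg (regular_pairC xy).
exact: (full_module_iso b_basis tlM Mm red xy x0 y0 icM).
Qed.

(** Otherwise there would be elements of orders exactly k1 and k2, whose product has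
    order k1 + k2. *)
Lemma order_dichotomy (J1 J2 : {pred R}) k1 k2 :
  {subset J1 <= ideal_exp m k1} -> {subset J2 <= ideal_exp m k2} ->
  (forall a b, a \in J1 -> b \in J2 -> a * b \in ideal_exp m (k1 + k2).+1) ->
  {subset J1 <= ideal_exp m k1.+1} \/ {subset J2 <= ideal_exp m k2.+1}.
Proof.
move=> J1m J2m J12; have [x [y xy]] := exists_regular_pair R_reg.
have [|noJ1] := pselect {subset J1 <= ideal_exp m k1.+1}; [by left|right].
move=> b Jb; apply: contrapT => /negP bN; apply: noJ1 => a Ja.
apply: contrapT => /negP aN.
by have := ideal_exp_domain R_reg xy (J1m _ Ja) aN (J2m _ Jb) bN; rewrite J12.
Qed.

Definition splits_max (M : lmodType R) e : Prop :=
  exists (l : nat) (L : lmodType R),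
     [/\ (1 <= l <= e)%N, indecomposable L, integrally_closed L &
         module_iso M ({ffun 'I_l -> submod_type m} * L)%type].

Lemma decomposableP (M : lmodType R) : ~ trivial_module M -> ~ indecomposable M ->
  exists N1 N2 : lmodType R, [/\ module_iso M (N1 * N2)%type,
    ~ trivial_module N1 & ~ trivial_module N2].
Proof.
move=> Mnt Mdec; apply: contrapT => noN; apply: Mdec; split=> // N1 N2 MN.
have [|N1nt] := pselect (trivial_module N1); [by left|right].
by apply: contrapT => N2nt; apply: noN; exists N1, N2.
Qed.

Lemma splits_max_sum (M N1 N2 : lmodType R) e1 e2 :
  summand_closed N1 -> module_iso M (N1 * N2)%type ->
  module_iso N2 {ffun 'I_e2 -> submod_type m} ->
  (0 < e2)%N -> ~ trivial_module N1 ->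
  (~ indecomposable N1 -> splits_max N1 e1) -> splits_max M (e1 + e2).
Proof.
move=> hN1 [h h_bij] [h2 h2_bij] e2_gt0 N1nt IH.
have [N1ind|/IH[l [L [/andP[l_gt0 le1] Lind Lic [h1 h1_bij]]]]] := pselect (indecomposable N1).
  exists e2, N1; split=> //; first by rewrite e2_gt0 leq_addl.
    by case: hN1.
  apply: (@module_iso_bijective _ _ _ (fun x => (h2 (h x).2, (h x).1))).
  - by move=> a u v; rewrite !linearP.
  - move=> u v [/(bij_inj h2_bij) e2uv e1uv]; apply: (bij_inj h_bij).
    by rewrite [h u]surjective_pairing [h v]surjective_pairing e1uv e2uv.
  - move=> [y z]; have [h' _ hK] := h_bij; have [h2' _ h2K] := h2_bij.
    by exists (h' (z, h2' y)); rewrite hK /= h2K.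
exists (l + e2)%N, L; split=> //.
  by rewrite addn_gt0 l_gt0 leq_add2r.
pose F x : {ffun 'I_(l + e2) -> submod_type m} := [ffun k =>
  match fintype.split k with inl j => (h1 (h x).1).1 j | inr j => h2 (h x).2 j end].
apply: (@module_iso_bijective _ _ _ (fun x => (F x, (h1 (h x).1).2))).
- move=> a u v; congr (_, _); last by rewrite !linearP.
  by apply/ffunP => k; rewrite !ffunE; case: fintype.split => j; rewrite !linearP !ffunE.
- move=> u v [/ffunP Fuv e2uv]; apply: (bij_inj h_bij).
  rewrite [h u]surjective_pairing [h v]surjective_pairing; congr (_, _).
    apply: (bij_inj h1_bij); rewrite [h1 (h u).1]surjective_pairing e2uv.
    rewrite [h1 (h v).1]surjective_pairing; congr (_, _).
    apply/ffunP => j; have := Fuv (lshift e2 j).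
    by rewrite !ffunE (unsplitK (inl _ j)).
  apply: (bij_inj h2_bij); apply/ffunP => j; have := Fuv (rshift l j).
  by rewrite !ffunE (unsplitK (inr _ j)).
- move=> [w z]; have [h' _ hK] := h_bij.
  have [h1' _ h1K] := h1_bij; have [h2' _ h2K] := h2_bij.
  exists (h' (h1' ([ffun j => w (lshift e2 j)], z), h2' [ffun j => w (rshift l j)])).
  congr (_, _); last by rewrite hK /= h1K.
  apply/ffunP => k; rewrite !ffunE hK /= h1K h2K -(splitK k).
  by case: (fintype.split k) => j; rewrite ?(unsplitK (inl _ j)) ?(unsplitK (inr _ j)) ffunE.
Qed.

Lemma iso_prodC (M N1 N2 : lmodType R) :
  module_iso M (N1 * N2)%type -> module_iso M (N2 * N1)%type.
Proof.
move=> [h [h' hK h'K]]; apply: (@module_iso_bijective _ _ _ (fun x => ((h x).2, (h x).1))).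
- by move=> a u v; rewrite !linearP.
- move=> u v [e2 e1]; apply: (can_inj hK).
  by rewrite [h u]surjective_pairing [h v]surjective_pairing e1 e2.
- by move=> [y z]; exists (h' (z, y)); rewrite h'K.
Qed.

Lemma iso_prod_data (M N1 N2 : lmodType R) : module_iso M (N1 * N2)%type ->
  exists (i1 : {linear N1 -> M}) (p1 : {linear M -> N1})
         (i2 : {linear N2 -> M}) (p2 : {linear M -> N2}),
  [/\ cancel i1 p1, cancel i2 p2, forall x, p1 (i2 x) = 0, forall x, p2 (i1 x) = 0 &
      forall x, x = i1 (p1 x) + i2 (p2 x)].
Proof.
case/module_iso_can=> h [g [hK gK]].
have p1_lin : linear (fun x => (h x).1) by move=> a u v; rewrite linearP.
have p2_lin : linear (fun x => (h x).2) by move=> a u v; rewrite linearP.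
have i1_lin : linear (fun y : N1 => g (y, 0)).
  by move=> a u v; rewrite -linearP; congr (g (_, _)); rewrite /= scaler0 addr0.
have i2_lin : linear (fun y : N2 => g (0, y)).
  by move=> a u v; rewrite -linearP; congr (g (_, _)); rewrite /= scaler0 addr0.
exists (mk_linear i1_lin), (mk_linear p1_lin), (mk_linear i2_lin), (mk_linear p2_lin).
split=> x /=; rewrite ?gK // -linearD /= -[LHS]hK; congr (g _).
by rewrite [LHS]surjective_pairing; congr (_, _); rewrite /= ?addr0 ?add0r.
Qed.

(** The hypotheses of the main theorem in the form that is inherited by the summand
    that remains when copies of m are split off: integral dependence becomes the
    reduction property. *)
Definition splitting_hypotheses (M : lmodType R) e : Prop :=
  [/\ summand_closed M, exists b : 'I_e -> dual M, is_basis b,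
      {subset minors M e <= ideal_exp m e.+1} & minors_reduction m M (e - 1)].

(** The summand N1, whose maximal minors have excess order, inherits the hypotheses;
    the maximal minors of N2 reduce m^e2, so that N2 is a sum of copies of m. *)
Lemma splits_max_summand (M N1 N2 : lmodType R) e1 e2
    (b1 : 'I_e1 -> dual N1) (b2 : 'I_e2 -> dual N2) :
  summand_closed M -> minors_reduction m M (e1 + e2 - 1) -> module_iso M (N1 * N2)%type ->
  ~ trivial_module N1 -> ~ trivial_module N2 -> is_basis b1 -> is_basis b2 ->
  {subset minors N1 e1 <= ideal_exp m e1.+1} ->
  (splitting_hypotheses N1 e1 -> ~ indecomposable N1 -> splits_max N1 e1) ->
  splits_max M (e1 + e2).
Proof.
move=> hM redM MN N1nt N2nt b1_basis b2_basis ord1 IH.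
have [i1 [p1 [i2 [p2 [iK1 iK2 p1i2 p2i1 ipD]]]]] := iso_prod_data MN.
have hN1 := summand_closed_retract iK1 hM; have hN2 := summand_closed_retract iK2 hM.
have [_ tl1 _ _] := hN1; have [_ tl2 _ _] := hN2; have [_ _ _ Mm] := hM.
have e1_gt0 := basis_gt0 tl1 N1nt b1_basis; have e2_gt0 := basis_gt0 tl2 N2nt b2_basis.
have [red2 red1] :=
  minors_sum_reduce iK1 iK2 p1i2 p2i1 ipD b1_basis b2_basis Mm ord1 R_reg e1_gt0 redM.
apply: (splits_max_sum hN1 MN) => //; first exact: full_summand hN2 b2_basis red2.
by apply: IH; split=> //; exists b1.
Qed.

(** Induction on the rank. By [order_dichotomy] the maximal minors of one of two
    complementary summands have excess order, and [splits_max_summand] splits off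
    the other one. *)
Theorem splitting_induction (M : lmodType R) e :
  splitting_hypotheses M e -> ~ indecomposable M -> splits_max M e.
Proof.
have [n] := ubnP e; elim: n => // n IH in M e *; rewrite ltnS => en.
move=> [hM [b b_basis] ordM redM] Mdec.
have [noeR locR _ _] := R_reg; have [fgM tlM icM Mm] := hM.
have e_gt0 : (0 < e)%N.
  rewrite lt0n; apply/eqP => e0; have /negP := one_notin_max locR; case.
  apply: ideal_exp1_sub; move: ordM; rewrite e0; apply.
  rewrite -(det1 R 0); apply: (@minors_laplace0 _ _ _ _ finset.set0 _ (fun=> 0) (fun=> 0)) => //.
  by move=> i j; rewrite inE.
have Mnt : ~ trivial_module M.
  move=> M0; have /eqP[] := oner_neq0 R.
  apply: (b_basis.2 (fun=> 1)) (Ordinal e_gt0); apply: dual_ext => x.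
  by rewrite dual_fun_sum big1 // => i _; rewrite (M0 x) linear0 mulr0.
have [N1 [N2 [MN N1nt N2nt]]] := decomposableP Mnt Mdec.
have [i1 [p1 [i2 [p2 [iK1 iK2 p1i2 p2i1 ipD]]]]] := iso_prod_data MN.
have hN1 := summand_closed_retract iK1 hM; have hN2 := summand_closed_retract iK2 hM.
have [fg1 tl1 _ m1] := hN1; have [fg2 tl2 _ m2] := hN2.
have [e1 [b1 b1_basis]] := dual_free R_reg fg1.
have [e2 [b2 b2_basis]] := dual_free R_reg fg2.
have e1_gt0 := basis_gt0 tl1 N1nt b1_basis; have e2_gt0 := basis_gt0 tl2 N2nt b2_basis.
have sb := sum_basis_basis iK1 iK2 p1i2 p2i1 ipD b1_basis b2_basis.
have De : e = (e1 + e2)%N.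
  by apply/eqP; rewrite eqn_leq (basis_size_le b_basis.1 sb) (basis_size_le sb.1 b_basis).
rewrite {b b_basis}De in en e_gt0 ordM redM *.
have [ord1|ord2] := order_dichotomy (minors_in_exp (s := e1) m1) (minors_in_exp (s := e2) m2)
   (fun a b Ja Jb => ordM _ (minors_sum_mul iK1 iK2 p1i2 p2i1 Ja Jb)).
  apply: (splits_max_summand hM redM MN N1nt N2nt b1_basis b2_basis ord1).
  by apply: IH; apply: leq_trans en; rewrite -addn1 leq_add2l.
rewrite addnC in redM en *.
apply: (splits_max_summand hM redM (iso_prodC MN) N2nt N1nt b2_basis b1_basis ord2).
by apply: IH; apply: leq_trans en; rewrite -addn1 leq_add2l.
Qed.

End Main.

Theorem theorem4p2 (R : idomainType) (m : submodClosed R^o)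
    (R_reg : regular_local m 2)
    (residue_inf : infinite_set [set: quot_mod m])
    (M : lmodType R) (e : nat)
    (M_fg : finitely_generated M) (M_tf : torsion_free M)
    (M_ic : integrally_closed M) (M_nofree : ~ has_free_summand M)
    (M_rank : has_rank M e) (e_ge2 : (2 <= e)%N)
    (ord_I : exists2 n, is_ord m (fitt0_bidual M) n & (e.+1 <= n)%N)
    (clos_I1 : integral_closure (fitt1_bidual M) =i ideal_exp (R := R) m (e - 1))
    (M_dec : ~ indecomposable M) :
  (exists (l : nat) (L : lmodType R),
     [/\ (1 <= l <= e)%N, indecomposable L, integrally_closed L &
         module_iso M ({ffun 'I_l -> submod_type m} * L)%type]) /\
  direct_summand (submod_type m) M.
Proof.
have [noeR locR _ _] := R_reg.
have tlM := has_rank_torsionless M_fg M_tf M_rank.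
have Mm := no_free_summand_dual noeR locR M_nofree.
have [n [b b_basis]] := dual_free R_reg M_fg.
have Dn := rank_dual_basis M_fg M_tf M_rank b_basis; subst n.
have [x [y xy]] := exists_regular_pair R_reg.
have : splits_max m M e.
  apply: (splitting_induction R_reg) M_dec; split=> //; first by exists b.
    apply: (minors_sub_fitt0 b_basis); have [n [F0n _] en] := ord_I.
    by move=> a /F0n; exact: ideal_exp_le.
  apply: (integral_reduction xy (fitt1_sub_minors b_basis) (minors_in_exp Mm)).
  by move=> a; rewrite clos_I1.
move=> spl; split=> //; case: spl => -[|l] [L [// _ _ _ [h h_bij]]].
exists ({ffun 'I_l -> submod_type m} * L)%type.
apply: (@module_iso_bijective _ _ _ (fun x =>
  ((h x).1 ord0, ([ffun j => (h x).1 (lift ord0 j)], (h x).2)))).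
- move=> a u v; congr (_, (_, _)); rewrite ?linearP ?ffunE //.
  by apply/ffunP => j; rewrite !ffunE.
- move=> u v [uv0 /ffunP uvS uv2]; apply: (bij_inj h_bij).
  rewrite [h u]surjective_pairing [h v]surjective_pairing uv2; congr (_, _).
  apply/ffunP => k; case: (unliftP ord0 k) => [j ->|->] //.
  by have := uvS j; rewrite !ffunE.
- move=> [z0 [w z]]; have [h' _ hK] := h_bij.
  exists (h' ([ffun k => if unlift ord0 k is Some j then w j else z0], z)).
  rewrite hK /= ffunE unlift_none; congr (_, (_, _)).
  by apply/ffunP => j; rewrite !ffunE liftK.
Qed.
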